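(* There exists a universal constant $c>0$ such that the following holds. Let $d\ge 1$, $L>0$, $R>0$, $\zeta\ge 0$, $\sigma_*\ge 0$, and let $f(x)=\mathbb{E}_{\xi\sim\mathcal D}[f(x,\xi)]$ on $\mathbb{R}^d$ satisfy: (i) for almost every $\xi$, $f(\cdot,\xi)$ is non-negative and convex: $f(y,\xi)\ge f(x,\xi)+\langle\nabla f(x,\xi),y-x\rangle$ for all $x,y\in\mathbb{R}^d$; (ii) for almost every $\xi$, $f(\cdot,\xi)$ is non-negative and $L$-smooth: $f(y,\xi)\le f(x,\xi)+\langle\nabla f(x,\xi),y-x\rangle+\frac L2\|y-x\|^2$ for all $x,y\in\mathbb{R}^d$; (iii) $f$ is convex and has a minimum value $f^*=\min_{x\in\mathbb{R}^d} f(x)$, attained at a point $x^*$ with $\|x^*\|\le R$; (iv) $\mathbb{E}\big[\|\nabla f(x^*,\xi)-\nabla f(x^* )\|^2\big]\le\sigma_*^2$. Let $\mathbf g(x,\xi)=\nabla f(x,\xi)+\mathbf b(x)$ be a biased gradient oracle, where $\mathbf b:\mathbb{R}^d\to\mathbb{R}^d$ satisfies $\|\mathbf b(x)\|^2\le\zeta^2$ for all $x\in\mathbb{R}^d$. Then, for every number of iterations $N\ge 1$, batch size $B\ge 1$ and starting point $x_0\in\mathbb{R}^d$, the output $x_N^{ag}$ of the Biased AC-SA algorithm (defined in the context) satisfies $$\mathbb{E}\big[f(x_N^{ag})-f^*\big]\le c\cdot\left(\frac{LR^2}{N^2}+\frac{LR^2}{BN}+\frac{\sigma_*R}{\sqrt{BN}}+\zeta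 R+\frac{\zeta^2}{2L}N\right).$$
   Context: $\|\cdot\|$ is the Euclidean norm and $\langle\cdot,\cdot\rangle$ the standard inner product on $\mathbb{R}^d$. $\nabla f(x,\xi)$ denotes the gradient with respect to $x$ (each $f(\cdot,\xi)$ is differentiable), and $\mathcal D$ is the distribution of $\xi$. $\mathbb{E}$ is the full expectation. Biased AC-SA algorithm. Input: $x_0^{ag}=x_0\in\mathbb{R}^d$, number of iterations $N$, batch size $B$ (positive integers). Let $\gamma=\min\left\{\frac1{12L},\frac{B}{24L(N+1)},\sqrt{\frac{BR^2}{\sigma_*^2N^3}}\right\}$ (the last entry is $+\infty$ if $\sigma_*=0$). For $k=0,\dots,N-1$, set $\beta_k=1+\frac k6$, $\gamma_k=\gamma(k+1)$ and 1. $x_k^{md}=\beta_k^{-1}x_k+(1-\beta_k^{-1})x_k^{ag}$; 2. draw fresh i.i.d. $\xi_1,\dots,\xi_B\sim\mathcal D$, independent of the past, and compute the batched oracle $\mathbf g^B(x_k^{md})=\frac1B\sum_{i=1}^B\mathbf g(x_k^{md},\xi_i)$; 3. $\tilde x_{k+1}=x_k-\gamma_k\,\mathbf g^B(x_k^{md})$; 4. $x_{k+1}=\min\left\{1,\frac{R}{\|\tilde x_{k+1}\|}\right\}\tilde x_{k+1}$ (Euclidean projection onto the ball of radius $R$ centred at $0$); 5. $x_{k+1}^{ag}=\beta_k^{-1}x_{k+1}+(1-\beta_k^{-1})x_k^{ag}$. Output: $x_N^{ag}$. *)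

(* Defs.v *)
From HB Require Import structures.
From mathcomp Require Import all_boot all_order all_algebra.
From mathcomp Require Import all_classical all_reals all_analysis.
Import Order.TTheory GRing.Theory Num.Theory.
Import numFieldNormedType.Exports.

Set Implicit Arguments.
Unset Strict Implicit.
Unset Printing Implicit Defensive.

Local Open Scope classical_set_scope.
Local Open Scope ring_scope.

Section Euclidean.
Context {R : realType} {d : nat}.
Implicit Types x y : 'rV[R]_d.

Definition dotp x y : R := \sum_(i < d) x 0 i * y 0 i.

(* The library norm `|x| on 'rV[R]_d is the sup norm; it induces the same
   topology and the same notion of differentiability. *)
Definition enorm x : R := Num.sqrt (dotp x x).

(* The vector of partial derivatives: it is the gradient wherever f is
   differentiable. *)
Definition grad (f : 'rV[R]_d -> R) x : 'rV[R]_d :=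
  \row_(i < d) 'D_(delta_mx 0 i) f x.

(* For x = 0 the convention r / 0 = 0 is harmless: the value is 0 anyway. *)
Definition proj_ball (r : R) x : 'rV[R]_d := Num.min 1 (r / enorm x) *: x.

End Euclidean.

(* R^d with its Borel sigma-algebra. *)
Definition borel_rV (R : realType) (d : nat) := g_sigma_algebraType (@open 'rV[R]_d).

Section Sampling.
Context {R : realType} {dO dT : measure_display}.
Context {Omega : measurableType dO} {T : measurableType dT}.

Definition mutually_independent (P : probability Omega R) (I : finType)
    (X : I -> Omega -> T) : Prop :=
  forall (J : {set I}) (A : I -> set T), (forall i, measurable (A i)) ->
    P (\bigcap_(i in [set` J]) (X i @^-1` A i)) =
    (\prod_(i in J) P (X i @^-1` A i))%E.

Definition iid_sample (P : probability Omega R) (D : probability T R)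
    (I : finType) (X : I -> Omega -> T) : Prop :=
  [/\ forall i, measurable_fun [set: Omega] (X i),
      forall i (A : set T), measurable A -> P (X i @^-1` A) = D A
    & mutually_independent P X].

End Sampling.

Section Objective.
Context {R : realType} {d : nat} {dT : measure_display} {T : measurableType dT}.

(* Meaningful when each f x is D-integrable. *)
Definition objective (D : probability T R) (f : 'rV[R]_d -> T -> R)
    (x : 'rV[R]_d) : R := fine 'E_D[f x].

Definition biased_oracle (f : 'rV[R]_d -> T -> R) (b : 'rV[R]_d -> 'rV[R]_d)
    (x : 'rV[R]_d) (z : T) : 'rV[R]_d := grad (f^~ z) x + b x.

Definition batched_oracle (g : 'rV[R]_d -> T -> 'rV[R]_d) (B : nat)
    (z : 'I_B -> T) (x : 'rV[R]_d) : 'rV[R]_d :=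
  B%:R^-1 *: \sum_(i < B) g x (z i).

End Objective.

Section ACSA.
Context {R : realType} {d : nat}.

Definition acsa_gamma (L r sigma : R) (N B : nat) : R :=
  let g := Num.min (1 / (12 * L)) (B%:R / (24 * L * N.+1%:R)) in
  if sigma == 0 then g
  else Num.min g (Num.sqrt (B%:R * r ^+ 2 / (sigma ^+ 2 * N%:R ^+ 3))).

Definition acsa_beta (k : nat) : R := 1 + k%:R / 6.

(* One step: s = (x_k, x_k^ag) is mapped to (x_{k+1}, x_{k+1}^ag), where gB is
   the batched oracle of iteration k. *)
Definition acsa_step (gamma r : R) (gB : 'rV[R]_d -> 'rV[R]_d) (k : nat)
    (s : 'rV[R]_d * 'rV[R]_d) : 'rV[R]_d * 'rV[R]_d :=
  let beta := acsa_beta k in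
  let xmd := beta^-1 *: s.1 + (1 - beta^-1) *: s.2 in
  let xtilde := s.1 - (gamma * k.+1%:R) *: gB xmd in
  let xnext := proj_ball r xtilde in
  (xnext, beta^-1 *: xnext + (1 - beta^-1) *: s.2).

Fixpoint acsa_iter (gamma r : R) (gB : nat -> 'rV[R]_d -> 'rV[R]_d)
    (x0 : 'rV[R]_d) (k : nat) : 'rV[R]_d * 'rV[R]_d :=
  if k is k'.+1 then acsa_step gamma r (gB k') k' (acsa_iter gamma r gB x0 k')
  else (x0, x0).

(* z k i is the i-th sample drawn at iteration k; only k < N is read. *)
Definition acsa_output {dT : measure_display} {T : measurableType dT}
    (L r sigma : R) (N B : nat) (g : 'rV[R]_d -> T -> 'rV[R]_d)
    (z : nat -> 'I_B -> T) (x0 : 'rV[R]_d) : 'rV[R]_d :=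
  (acsa_iter (acsa_gamma L r sigma N B) r
     (fun k => batched_oracle g (z k)) x0 N).2.

End ACSA.

(* Main.v *)
Require Import Defs.
From HB Require Import structures.
From mathcomp Require Import all_boot all_order all_algebra.
From mathcomp Require Import all_classical all_reals all_analysis.
From mathcomp Require Import measurable_realfun ring lra.
Import Order.TTheory GRing.Theory Num.Theory.
Import numFieldNormedType.Exports.
Set Implicit Arguments.
Unset Strict Implicit.
Unset Printing Implicit Defensive.
Local Open Scope classical_set_scope.
Local Open Scope ring_scope.

(* Write phi_k = F(x_k^ag) - F(xs), g_k = gamma (k+1), and split the batched
   oracle into gradient + bias + noise. Smoothness, convexity at x_k^ag and at
   the minimizer xs, and the projection inequality give, for every realization,
     beta_k g_k phi_{k+1} <= (beta_k - 1) g_k phi_k + |x_k - xs|^2 / 2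
       - |x_{k+1} - xs|^2 / 2 + 2 r zeta g_k + g_k^2 |noise|^2
       - g_k <noise, x_k - xs>.
   The samples of step k are independent of (x_k, x_k^ag), so the last term has
   mean zero and E |noise|^2 is at most 1/B times the variance of one sampled
   gradient. Cocoercivity bounds the variance at x by
   4 L (F x - F xs) + 2 sigma^2, and at the extrapolated point
   F - F(xs) <= 2 phi_k + 4 L r^2 / beta_k^2. The choice of beta_k and
   gamma <= B / (24 L (N+1)) leaves enough slack in the potential
   gamma k (k+5) / 6 * phi_k + |x_k - xs|^2 / 2 to absorb the resulting
   multiple of phi_k. The summation starts at k = 1, where both iterates lie in
   the ball of radius r whatever x_0 is. *)

(** * Euclidean geometry and the pathwise descent inequality *)

Section EuclideanTheory.
Context {R : realType} {d : nat}.
Implicit Types (x y u : 'rV[R]_d) (a r : R).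

Lemma dotpC x y : dotp x y = dotp y x.
Proof. by apply: eq_bigr => i _; rewrite mulrC. Qed.

Lemma dotpDr x y u : dotp x (y + u) = dotp x y + dotp x u.
Proof. by rewrite -big_split; apply: eq_bigr => i _; rewrite mxE mulrDr. Qed.

Lemma dotpZr a x y : dotp x (a *: y) = a * dotp x y.
Proof. by rewrite mulr_sumr; apply: eq_bigr => i _; rewrite mxE mulrCA. Qed.

Lemma dotpNr x y : dotp x (- y) = - dotp x y.
Proof. by rewrite -scaleN1r dotpZr mulN1r. Qed.

Lemma dotpDl x y u : dotp (x + y) u = dotp x u + dotp y u.
Proof. by rewrite !(dotpC _ u) dotpDr. Qed.

Lemma dotpZl a x y : dotp (a *: x) y = a * dotp x y.
Proof. by rewrite !(dotpC _ y) dotpZr. Qed.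

Lemma dotpNl x y : dotp (- x) y = - dotp x y.
Proof. by rewrite !(dotpC _ y) dotpNr. Qed.

Lemma dotp0r x : dotp x 0 = 0.
Proof. by apply: big1 => i _; rewrite mxE mulr0. Qed.

Lemma dotp_sumr (I : finType) x (y : I -> 'rV[R]_d) :
  dotp x (\sum_i y i) = \sum_i dotp x (y i).
Proof.
by apply: (big_morph (dotp x)) => [? ?|]; rewrite (dotpDr, dotp0r).
Qed.

Lemma dotp_suml (I : finType) x (y : I -> 'rV[R]_d) :
  dotp (\sum_i y i) x = \sum_i dotp (y i) x.
Proof. by rewrite dotpC dotp_sumr; apply: eq_bigr => i _; rewrite dotpC. Qed.

Lemma dotp_delta i x : dotp x (delta_mx 0 i) = x 0 i.
Proof.
rewrite /dotp (bigD1 i)//= big1 => [|j ji]; rewrite mxE ?eqxx /= ?addr0 ?mulr1//.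
by rewrite (negbTE ji) mulr0.
Qed.

Definition dotpE := (dotpDl, dotpDr, dotpZl, dotpZr, dotpNl, dotpNr).

Lemma dotp_ge0 x : 0 <= dotp x x.
Proof. by apply: sumr_ge0 => i _; rewrite -expr2 sqr_ge0. Qed.

Lemma enorm_ge0 x : 0 <= enorm x.
Proof. exact: sqrtr_ge0. Qed.

Lemma enormK x : enorm x ^+ 2 = dotp x x.
Proof. by rewrite sqr_sqrtr // dotp_ge0. Qed.

Lemma dotp_eq0 x : dotp x x = 0 -> x = 0.
Proof.
move=> /eqP; rewrite psumr_eq0 => [/allP x0|i _]; last by rewrite -expr2 sqr_ge0.
apply/rowP => i; rewrite mxE; apply/eqP.
by have := x0 i (mem_index_enum _); rewrite mulf_eq0 orbb.
Qed.

(** Expanding the square norm of [dotp y y *: x - dotp x y *: y] gives [dotp y y] times the gap. *)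
Lemma dotp_sqr_le x y : dotp x y ^+ 2 <= dotp x x * dotp y y.
Proof.
have [/dotp_eq0 ->|y0] := eqVneq (dotp y y) 0.
  by rewrite !dotp0r mulr0 expr0n.
have yp : 0 < dotp y y by rewrite lt_neqAle eq_sym y0 dotp_ge0.
have := dotp_ge0 (dotp y y *: x - dotp x y *: y).
rewrite !dotpE (dotpC y x) => h.
have : 0 <= dotp y y * (dotp x x * dotp y y - dotp x y ^+ 2) by lra.
by rewrite pmulr_rge0// subr_ge0.
Qed.

Lemma cauchy_schwarz x y : dotp x y <= enorm x * enorm y.
Proof.
apply: le_trans (ler_norm _) _.
rewrite -(@ler_pXn2r _ 2) ?nnegrE// ?mulr_ge0 ?enorm_ge0//.
by rewrite -normrX ger0_norm ?sqr_ge0// exprMn !enormK dotp_sqr_le.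
Qed.

Lemma young x y : 2 * dotp x y <= dotp x x + dotp y y.
Proof.
have := dotp_ge0 (x - y); rewrite !dotpE (dotpC y x); lra.
Qed.

Lemma youngN x y : - (2 * dotp x y) <= dotp x x + dotp y y.
Proof. by have := young (- x) y; rewrite !dotpE; lra. Qed.

Lemma dotp_le_sqr r x : enorm x <= r -> dotp x x <= r ^+ 2.
Proof. by move=> xr; have := enorm_ge0 x; rewrite -enormK; nra. Qed.

Lemma dotpB_le_sqr r x y : enorm x <= r -> enorm y <= r ->
  dotp (x - y) (x - y) <= 4 * r ^+ 2.
Proof.
move=> /dotp_le_sqr xr /dotp_le_sqr yr.
by have := youngN x y; rewrite !dotpE (dotpC y x); lra.
Qed.

(** After squaring, Young's inequality on the cross term leaves the convex combination of the two
    squared norms. *)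
Lemma enorm_convex r a x y : 0 <= a <= 1 -> enorm x <= r -> enorm y <= r ->
  enorm (a *: x + (1 - a) *: y) <= r.
Proof.
move=> a01 xr yr; have r0 : 0 <= r := le_trans (enorm_ge0 x) xr.
rewrite -(@ler_pXn2r _ 2) ?nnegrE ?enorm_ge0// enormK.
have := young x y; have := dotp_le_sqr xr; have := dotp_le_sqr yr.
rewrite !dotpE (dotpC y x); move: (dotp x x) (dotp y y) (dotp x y) => p q s.
move: a01 => /andP[a0 a1] qr pr spq; have {}a1 : 0 <= 1 - a by rewrite subr_ge0.
have h1 := ler_wpM2l (mulr_ge0 a0 a1) spq.
have h2 := ler_wpM2l a0 pr; have h3 := ler_wpM2l a1 qr.
by lra.
Qed.

Lemma enorm_proj_ball r x : 0 < r -> enorm (proj_ball r x) <= r.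
Proof.
move=> r0; rewrite -(@ler_pXn2r _ 2) ?nnegrE ?enorm_ge0// ?(ltW r0)// enormK !dotpE -enormK.
have [->|x0] := eqVneq (enorm x) 0.
  by rewrite expr0n /= !mulr0 sqr_ge0.
have n0 : 0 < enorm x by rewrite lt_neqAle eq_sym x0 enorm_ge0.
set m := Num.min _ _.
have m0 : 0 <= m by rewrite le_min ler01 divr_ge0 // ltW.
have : m * enorm x <= r by rewrite -ler_pdivlMr// ge_min lexx orbT.
have : 0 <= m * enorm x by rewrite mulr_ge0// ltW.
by nra.
Qed.

(** Obtuse-angle characterization of the projection onto the ball. *)
Lemma proj_ball_dotp r x u : 0 < r -> enorm u <= r ->
  dotp (x - proj_ball r x) (u - proj_ball r x) <= 0.
Proof.
move=> r0 ur; rewrite /proj_ball.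
have [x0|x0] := eqVneq (enorm x) 0.
  have := dotp_sqr_le x u.
  rewrite -enormK x0 expr0n /= mul0r => h.
  have xu : dotp x u = 0 by apply/eqP; rewrite -sqrf_eq0 eq_le h sqr_ge0.
  (* Here [r / 0 = 0], so the scaling factor is 0 and the projection is the origin. *)
  by rewrite invr0 mulr0 (min_r ler01) scale0r !subr0 xu.
have n0 : 0 < enorm x by rewrite lt_neqAle eq_sym x0 enorm_ge0.
have [h|h] := leP 1 (r / enorm x).
  by rewrite scale1r subrr dotpC dotp0r.
set t := r / enorm x in h *.
have tx : t * enorm x = r by rewrite divfK// gt_eqF.
have xE : dotp x x = enorm x * enorm x by rewrite -enormK expr2.
have -> : dotp (x - t *: x) (u - t *: x) =
    (1 - t) * (dotp x u - enorm x * (t * enorm x)).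
  by rewrite !dotpE xE; ring.
rewrite tx; apply: mulr_ge0_le0; first by rewrite subr_ge0 ltW.
rewrite subr_le0; apply: le_trans (cauchy_schwarz _ _) _.
exact: ler_wpM2l (enorm_ge0 _) _ _ ur.
Qed.

End EuclideanTheory.

(** * Smooth convex functions and one realization of a step *)

Section SmoothConvex.
Context {R : realType} {d : nat}.
Variables (L : R) (F : 'rV[R]_d -> R) (G : 'rV[R]_d -> 'rV[R]_d).
Variable xs : 'rV[R]_d.
Hypothesis L0 : 0 < L.
Hypothesis Fconvex : forall x y, F x + dotp (G x) (y - x) <= F y.
Hypothesis Fsmooth : forall x y,
  F y <= F x + dotp (G x) (y - x) + L / 2 * dotp (y - x) (y - x).
Hypothesis Fmin : forall x, F xs <= F x.

(** The minimum lies below the quadratic upper model at the gradient step [x - L^-1 *: G x], whose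
    value is [F x - dotp (G x) (G x) / (2 * L)]. *)
Lemma smooth_sqr_gradient x : dotp (G x) (G x) <= 2 * L * (F x - F xs).
Proof.
have := le_trans (Fmin _) (Fsmooth x (x - L^-1 *: G x)).
rewrite [x - _]addrC addrK !dotpE => h.
have LV : L * L^-1 = 1 by rewrite divff ?gt_eqF.
set g := dotp _ _ in h *; set m := L^-1 in h LV.
have Lmg : L * m * g = g by rewrite LV mul1r.
have Lmmg : L * m * (m * g) = m * g by rewrite LV mul1r.
have {}h : F xs <= F x - m * g / 2 by lra.
by have := ler_wpM2l (ltW L0) h; lra.
Qed.

Lemma gradient_argmin_eq0 : G xs = 0.
Proof.
apply: dotp_eq0; apply/eqP; rewrite eq_le dotp_ge0 andbT.
by have := smooth_sqr_gradient xs; rewrite subrr mulr0.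
Qed.

Lemma smooth_gap_le x r : enorm x <= r -> enorm xs <= r ->
  F x - F xs <= 2 * L * r ^+ 2.
Proof.
move=> xr xsr; have := Fsmooth xs x.
rewrite gradient_argmin_eq0 dotpC dotp0r.
have := ler_wpM2l (ltW L0) (dotpB_le_sqr xr xsr); lra.
Qed.

(** [G] is an abstract field, whereas [grad F] is made of partial derivatives. Around [xs] the
    increments of [F] lie between 0 and [L / 2] times the squared step, so every difference quotient
    tends to 0. *)
Lemma grad_argmin_eq0 : grad F xs = 0.
Proof.
apply/rowP => i; rewrite !mxE.
set v := delta_mx 0 i; apply: (@cvg_lim _ (@Rhausdorff R)).
apply/cvgrPdist_le => e e0 /=.
have eL : 0 < e / L by rewrite divr_gt0.
apply: filterS (dnbhs0_lt eL) => h heL.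
rewrite sub0r normrN normrZ normfV.
have [->|h0] := eqVneq h 0; first by rewrite normr0 invr0 mul0r ltW.
rewrite mulrC ler_pdivrMr ?normr_gt0//.
have := Fsmooth xs (h *: v + xs); have := Fmin (h *: v + xs).
rewrite addrK gradient_argmin_eq0 dotpC dotp0r addr0 dotpZl dotpZr dotp_delta.
rewrite mxE !eqxx /= mulr1 => lo hi.
rewrite ger0_norm ?subr_ge0//.
have h2 : h * h = `|h| ^+ 2 by rewrite -normrX ger0_norm ?sqr_ge0// expr2.
rewrite h2 in hi.
have : `|h| * L <= e by rewrite -ler_pdivlMr// ltW.
have := normr_ge0 h; nra.
Qed.

Lemma extrapolation_gap_le r c x y : enorm x <= r -> enorm y <= r ->
  F (c *: x + (1 - c) *: y) - F xs <=
  2 * (F y - F xs) + 4 * L * c ^+ 2 * r ^+ 2.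
Proof.
move=> xr yr; have := Fsmooth y (c *: x + (1 - c) *: y).
have -> : c *: x + (1 - c) *: y - y = c *: (x - y).
  by rewrite scalerBl scale1r scalerBr [y - _]addrC addrA addrK.
have := dotpB_le_sqr xr yr; have := smooth_sqr_gradient y.
(* With the weight [L * c], the cross term of the smoothness bound is traded for [dotp (G y) (G y)],
   which is controlled by the gap at [y]. *)
have := young (G y) ((L * c) *: (x - y)); rewrite (dotpZr c) (dotpZl c) (dotpZr c).
rewrite (dotpZr (L * c)) (dotpZl (L * c)) (dotpZr (L * c)).
move: (dotp _ _) (dotp _ _) (dotp _ _) (F _) (F y) (F xs) => w g q Fm Fy Fs.
move=> h1 h2 h3 h4.
suff : 2 * L * (Fm - Fs) <= 2 * L * (2 * (Fy - Fs) + 4 * L * c ^+ 2 * r ^+ 2).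
  by rewrite ler_pM2l // mulr_gt0 ?ltr0n.
have h5 : (L * c) ^+ 2 * w <= (L * c) ^+ 2 * (4 * r ^+ 2).
  by rewrite ler_wpM2l ?sqr_ge0.
have := ler_wpM2l (ltW L0) h4.
by lra.
Qed.

Lemma acsa_descent (r zeta gamma : R) (k : nat) (gB : 'rV[R]_d -> 'rV[R]_d)
    (s : 'rV[R]_d * 'rV[R]_d) (bias noise : 'rV[R]_d) :
  let beta := acsa_beta k in
  let gk := gamma * k.+1%:R in
  let md := beta^-1 *: s.1 + (1 - beta^-1) *: s.2 in
  let s' := acsa_step gamma r gB k s in
  0 < r -> 0 <= gamma -> 12 * L * gamma <= 1 -> enorm xs <= r ->
  gB md = G md + bias + noise -> enorm bias <= zeta ->
  beta * gk * (F s'.2 - F xs) <= (beta - 1) * gk * (F s.2 - F xs)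
    + dotp (s.1 - xs) (s.1 - xs) / 2 - dotp (s'.1 - xs) (s'.1 - xs) / 2
    + 2 * r * zeta * gk + gk ^+ 2 * dotp noise noise
    - gk * dotp noise (s.1 - xs).
Proof.
case: s => x a /= r0 g0 gL xsr gBE bz.
set beta := acsa_beta k in gBE *; set md := _ *: _ + _ in gBE *.
rewrite gBE; set gk := gamma * _.
set x' := proj_ball _ _.
have gk0 : 0 <= gk by rewrite mulr_ge0.
have beta0 : 0 < beta by rewrite /beta /acsa_beta ltr_pwDl// divr_ge0.
have [bk bV] : beta = 1 + k%:R / 6 /\ beta * beta^-1 = 1.
  by rewrite divff ?gt_eqF.
have x'r : enorm x' <= r by exact: enorm_proj_ball.
(* The new average is the extrapolated point moved by [beta^-1 *: (x' - x)]; smoothness is applied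
   along this displacement. *)
have aE : beta^-1 *: x' + (1 - beta^-1) *: a = md + beta^-1 *: (x' - x).
  by apply/rowP => i; rewrite !mxE; ring.
rewrite aE.
have bmd : (beta - 1) *: (a - md) = md - x.
  by apply/rowP => i; rewrite !mxE; field; rewrite gt_eqF.
have h1 := Fsmooth md (md + beta^-1 *: (x' - x)).
rewrite [_ + _ - md]addrC addKr !(dotpZl beta^-1) !(dotpZr beta^-1) in h1.
set a' := md + _ in h1 *.
have h2 := Fconvex md a; have h3 := Fconvex md xs.
have h4 := proj_ball_dotp (x - gk *: (G md + bias + noise)) r0 xsr.
rewrite -/x' in h4.
have h5 : dotp bias (xs - x') <= 2 * r * zeta.
  apply: le_trans (cauchy_schwarz _ _) _; rewrite mulrC.
  apply: ler_pM; rewrite ?enorm_ge0//.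
  rewrite -(@ler_pXn2r _ 2) ?nnegrE ?enorm_ge0// ?mulr_ge0 ?(ltW r0)// enormK.
  by apply: le_trans (dotpB_le_sqr xsr x'r) _; lra.
(* The weight [2 * gk] makes the noise cost a quarter of [dotp (x' - x) (x' - x)]; by [gkL]
   smoothness costs another quarter, and the projection inequality supplies the half that pays for
   both. *)
have h6 := youngN ((2 * gk) *: noise) (x' - x).
(* From [gammaL]-type smallness, [gk * L <= (k + 1) / 12], which is at most
   [beta / 2 = 1 / 2 + k / 12]. *)
have gkL : gk * (L * beta^-1) <= 1 / 2.
  have : gk * L <= beta / 2.
    have := ler_wpM2r (ler0n R k.+1) gL.
    rewrite bk /gk -natr1; have := ler0n R k; lra.
  by rewrite mulrA ler_pdivrMr//; lra.
have h7 := ler_wpM2r (dotp_ge0 (x' - x)) gkL.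
have {}h2 : (beta - 1) * F md + dotp (G md) (md - x) <= (beta - 1) * F a.
  have b1 : 0 <= beta - 1 by rewrite bk addrAC subrr add0r divr_ge0.
  by rewrite -bmd dotpZr -mulrDr ler_wpM2l.
have {}h1 : beta * F a' <= beta * F md + dotp (G md) (x' - x)
    + L / 2 * beta^-1 * dotp (x' - x) (x' - x).
  apply: le_trans (ler_wpM2l (ltW beta0) h1) _.
  move: bV; move: (dotp _ _) (dotp _ _) => p q; set m := beta^-1 => bV.
  have e1 : beta * m * q = q by rewrite bV mul1r.
  have e2 : L * (beta * m * (m * p)) = L * (m * p) by rewrite bV mul1r.
  by lra.
(* The convexity bounds at [a] and [xs] enter with weights [beta - 1] and 1. The weights add up to
   [beta], so [F md] cancels and [bmd] reduces the inner products to [x' - xs]. *)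
have {h1 h2 h3} h : beta * F a' - (beta - 1) * F a - F xs <=
    dotp (G md) (x' - xs) + L / 2 * beta^-1 * dotp (x' - x) (x' - x).
  by move: h1 h2 h3; rewrite !dotpE; lra.
have := ler_wpM2l gk0 h; have := ler_wpM2l gk0 h5.
move: h4 h6 h7.
have := (dotpC x' x, dotpC xs x, dotpC xs x').
by rewrite !dotpE => -[[c1 c2] c3]; lra.
Qed.

End SmoothConvex.

(** Tilting [f] by [- dotp (g y) u] keeps it convex and smooth and makes [y] its minimizer;
    [smooth_sqr_gradient] for the tilted function is the claim. *)
Lemma cocoercive {R : realType} {d} (L : R) (f : 'rV[R]_d -> R)
    (g : 'rV[R]_d -> 'rV[R]_d) : 0 < L ->
  (forall x y, f x + dotp (g x) (y - x) <= f y) ->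
  (forall x y, f y <= f x + dotp (g x) (y - x) + L / 2 * dotp (y - x) (y - x)) ->
  forall x y, dotp (g x - g y) (g x - g y) <=
    2 * L * (f x - f y - dotp (g y) (x - y)).
Proof.
move=> L0 fc fs x y.
have -> : f x - f y - dotp (g y) (x - y) =
    (f x - dotp (g y) x) - (f y - dotp (g y) y) by rewrite !dotpE; ring.
apply: (@smooth_sqr_gradient R d L (fun u => f u - dotp (g y) u)
  (fun u => g u - g y)) => // [u v|u].
  by have := fs u v; rewrite !dotpE; lra.
by have := fc y u; rewrite !dotpE; lra.
Qed.

(** * Measurability *)

(** Working coordinatewise reduces vector operations to real functions. The equivalence with Borel
    measurability, in which the bias is specified, is proved below. *)
Definition measurable_coords {dW} {W : measurableType dW} {R : realType} {d}
  (u : W -> 'rV[R]_d) := forall i, measurable_fun [set: W] (fun w => u w 0 i).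

Section GridRounding.
Context {R : realType} {d : nat}.
Implicit Types x y : 'rV[R]_d.

(* Rounding a random vector to the grid of mesh 1/(n+1) makes it countably
   valued, so that measurability in x is free; continuity in x then lets n go
   to infinity. *)
Definition grid_code (n : nat) x : 'rV[int]_d :=
  \row_i Num.floor (x 0 i * n.+1%:R).

Definition grid_point (n : nat) (c : 'rV[int]_d) : 'rV[R]_d :=
  \row_i ((c 0 i)%:~R / n.+1%:R).

Lemma grid_point_ball n x : ball x n.+1%:R^-1 (grid_point n (grid_code n x)).
Proof.
have n0 : 0 < n.+1%:R :> R by [].
split; first by rewrite invr_gt0.
move=> i j; rewrite /ball /= !mxE ord1.
set t := x 0 j; have := floor_itv (t * n.+1%:R).
rewrite intrD => /andP[lo hi].
rewrite -[t in `|t - _|](mulfK (lt0r_neq0 n0)) -mulrBl normrM.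
rewrite [`|_^-1|]ger0_norm ?invr_ge0 ?ltW// -[ltRHS]mul1r.
rewrite ltr_pM2r ?invr_gt0// ger0_norm ?subr_ge0//; lra.
Qed.

Lemma grid_point_cvg x : grid_point n (grid_code n x) @[n --> \oo] --> x.
Proof.
apply/cvg_ballP => e e0.
have /cvgrPdist_lt/(_ e e0) := @cvg_harmonic R.
apply: filterS => n; rewrite sub0r normrN ger0_norm ?harmonic_ge0// => /ltW ne.
exact: le_ball ne _ (grid_point_ball n x).
Qed.

Context {dW : measure_display} {W : measurableType dW}.
Variable u : W -> 'rV[R]_d.
Hypothesis mu : measurable_coords u.

Lemma measurable_grid_code n (c : 'rV[int]_d) :
  measurable [set w | grid_code n (u w) = c].
Proof.
have -> : [set w | grid_code n (u w) = c] = \bigcap_(i : 'I_d)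
    ((fun w => u w 0 i * n.+1%:R) @^-1` `[(c 0 i)%:~R, (c 0 i + 1)%:~R[%classic).
  apply/seteqP; split => w /=.
    by move=> <- i _; rewrite /= in_itv /= mxE floor_itv.
  move=> h; apply/rowP => i; rewrite mxE; apply/eqP; rewrite floor_eq.
  by have := h i I; rewrite /= in_itv.
apply: fin_bigcap_measurable => // i _; rewrite -[X in measurable X]setTI.
by apply: measurable_funM => //; exact: mu.
Qed.

(** There are countably many integer codes, so the set splits into a countable union over the value
    of the code. *)
Lemma measurable_grid_preimage n (C : 'rV[int]_d -> set W) :
  (forall c, measurable (C c)) -> measurable [set w | C (grid_code n (u w)) w].
Proof.
move=> mC.
have -> : [set w | C (grid_code n (u w)) w] =
    \bigcup_c ([set w | grid_code n (u w) = c] `&` C c).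
  apply/seteqP; split => w /=; first by exists (grid_code n (u w)).
  by move=> [c _ /= [<-]].
apply: countable_bigcupT_measurable; first exact: countableP.
by move=> c; apply: measurableI => //; exact: measurable_grid_code.
Qed.

End GridRounding.

Section Caratheodory.
Context {R : realType} {d : nat} {dW dT : measure_display}.
Context {W : measurableType dW} {T : measurableType dT}.
Variables (f : 'rV[R]_d -> T -> R) (u : W -> 'rV[R]_d) (z : W -> T).
Hypothesis mf : forall x, measurable_fun setT (f x).
Hypothesis mu : measurable_coords u.
Hypothesis mz : measurable_fun setT z.

Lemma measurable_caratheodory : (forall t, continuous (f^~ t)) ->
  measurable_fun setT (fun w => f (u w) (z w)).
Proof.
move=> cf.
apply: (@measurable_fun_cvg _ _ _ setT
  (fun n w => f (grid_point n (grid_code n (u w))) (z w))) => [n|w _].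
  move=> _ Y mY; rewrite setTI.
  apply: (@measurable_grid_preimage R d _ _ u mu n
    (fun c => (fun w => f (grid_point n c) (z w)) @^-1` Y)) => c.
  rewrite -[X in measurable X]setTI.
  have : measurable_fun setT (f (grid_point n c) \o z) by apply: measurableT_comp.
  exact.
exact: (cvg_comp _ _ (@grid_point_cvg R d (u w)) (cf (z w) (u w))).
Qed.

End Caratheodory.

Section GradientMeasurable.
Context {R : realType} {d : nat} {dW dT : measure_display}.
Context {W : measurableType dW} {T : measurableType dT}.
Variables (f : 'rV[R]_d -> T -> R) (u : W -> 'rV[R]_d) (z : W -> T).
Hypothesis mf : forall x, measurable_fun setT (f x).
Hypothesis mu : measurable_coords u.
Hypothesis mz : measurable_fun setT z.

(** Each partial derivative is the pointwise limit of difference quotients with steps [1 / (n + 1)],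
    which are measurable by [measurable_caratheodory]. *)
Lemma measurable_grad : (forall t x, differentiable (f^~ t) x) ->
  measurable_coords (fun w => grad (f^~ (z w)) (u w)).
Proof.
move=> df i.
have cf t : continuous (f^~ t) by move=> x; exact: differentiable_continuous.
pose v : 'rV[R]_d := delta_mx 0 i.
have dv w : derivable (f^~ (z w)) (u w) v by exact: diff_derivable.
apply: (@measurable_fun_cvg _ _ _ setT (fun n w => (harmonic n)^-1 *
   (f (harmonic n *: v + u w) (z w) - f (u w) (z w)))) => [n|w _]; last first.
  rewrite mxE.
  have /cvgr_dnbhsP/(_ harmonic) := dv w.
  apply; split => [n|]; first by rewrite gt_eqF// harmonic_gt0.
  exact: cvg_harmonic.
apply: measurable_funM => //; apply: measurable_funB.
  apply: (measurable_caratheodory mf) => // j.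
  under eq_fun do rewrite !mxE.
  by apply: measurable_funD => //; exact: mu.
exact: (measurable_caratheodory mf).
Qed.

End GradientMeasurable.

Section Borel.
Context {R : realType} {d : nat} {dW : measure_display} {W : measurableType dW}.

Lemma measurable_borel_coords (u : W -> borel_rV R d) :
  measurable_fun setT u -> measurable_coords (u : W -> 'rV[R]_d).
Proof.
move=> mu i; apply: (measurability _ (RGenOpens.measurableE R)).
move=> _ [_ [a [b ->] <-]].
apply: (mu measurableT ((fun x : 'rV[R]_d => x 0 i) @^-1` `]a, b[%classic)).
apply: sub_sigma_algebra.
by apply: (open_comp _ (interval_open _ _)) => // x _; exact: coord_continuous.
Qed.

(** An open [U] is exhausted by the events that the ball of radius [1 / (n + 1)] around the rounded
    point is contained in [U]. *)
Lemma measurable_coords_borel (u : W -> 'rV[R]_d) :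
  measurable_coords u -> measurable_fun setT (u : W -> borel_rV R d).
Proof.
move=> mu; apply: (@measurability _ _ W (borel_rV R d) setT u (@open 'rV[R]_d) erefl) =>
  _ [U oU <-]; rewrite setTI.
pose e n : R := harmonic n.
pose C n (c : 'rV[int]_d) := [set _ : W | ball (grid_point n c) (e n) `<=` U].
(* [C n c] does not depend on the outcome: it is everything or empty. *)
have mC n c : measurable (C n c).
  have [h|h] := pselect (ball (grid_point n c) (e n) `<=` U).
    by rewrite (_ : C n c = setT)//; apply/seteqP; split.
  by rewrite (_ : C n c = set0)//; apply/seteqP; split.
have -> : u @^-1` U = \bigcup_n [set w | C n (grid_code n (u w)) w].
  apply/seteqP; split => w /=; last first.
    by move=> [n _ /=]; apply; apply: ball_sym; exact: grid_point_ball.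
  move=> /oU /nbhs_ballP[r /= r0 rU].
  have r20 : 0 < r / 2 by rewrite divr_gt0.
  have /cvgrPdist_lt/(_ _ r20)[n _ /(_ n (leqnn n))] := @cvg_harmonic R.
  rewrite sub0r normrN ger0_norm ?harmonic_ge0// => nr.
  exists n => //= y gy; apply: rU; rewrite [r]splitr.
  apply: ball_triangle (le_ball (ltW nr) gy).
  exact: le_ball (ltW nr) _ (grid_point_ball n (u w)).
apply: bigcupT_measurable => n.
exact: (@measurable_grid_preimage R d _ _ u mu n (C n) (mC n)).
Qed.

End Borel.

(** * Independence *)

(** Tonelli's measurability concerns non-negative integrands, so [h] is split into positive and
    negative parts. *)
Lemma measurable_fine_integral {R : realType} {dW dT : measure_display}
    {W : measurableType dW} {T : measurableType dT} (D : probability T R)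
    (h : W * T -> R) : measurable_fun setT h ->
  measurable_fun setT (fun w => \int[D]_t h (w, t)).
Proof.
move=> mh.
have mEh : measurable_fun setT (EFin \o h) by exact/measurable_EFinP.
have mp := measurable_fun_fubini_tonelli_F (m2 := D) _ (measurable_funepos mEh).
have mn := measurable_fun_fubini_tonelli_F (m2 := D) _ (measurable_funeneg mEh).
apply: measurableT_comp => //.
have -> : (fun w => \int[D]_t (h (w, t))%:E)%E =
    (fubini_F D ((EFin \o h)^\+) \- fubini_F D ((EFin \o h)^\-))%E.
  apply/funext => w; rewrite integralE.
  by congr (_ - _)%E; apply: eq_integral => t _; rewrite !(funeposE, funenegE).
by apply: emeasurable_funB; [apply: mp|apply: mn].
Qed.

Section IndependentFubini.
Context {R : realType} {dO dW dT : measure_display}.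
Context {Omega : measurableType dO} {W : measurableType dW} {T : measurableType dT}.
Variables (P : probability Omega R) (D : probability T R).
Variables (Y : Omega -> W) (X : Omega -> T).
Hypothesis mY : measurable_fun setT Y.
Hypothesis mX : measurable_fun setT X.
Hypothesis YX : forall A B, measurable A -> measurable B ->
  (P (Y @^-1` A `&` X @^-1` B) = P (Y @^-1` A) * D B)%E.

Let Ym : {mfun Omega >-> W} := HB.pack Y (isMeasurableFun.Build _ _ _ _ _ mY).
Let mYX := measurable_fun_pair mY mX.
Let YXm : {mfun Omega >-> (W * T)%type} :=
  HB.pack (fun w => (Y w, X w)) (isMeasurableFun.Build _ _ _ _ _ mYX).

(** By [YX] the two measures agree on measurable rectangles, which determine the product measure. *)
Let joint_law A : measurable A ->
  distribution P YXm A = (distribution P Ym \x D)%E A.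
Proof. by move=> mA; apply/esym/product_measure_unique. Qed.

Lemma ge0_independent_integral (h : W * T -> \bar R) :
  measurable_fun setT h -> (forall p, 0 <= h p)%E ->
  (\int[P]_w h (Y w, X w) = \int[P]_w \int[D]_t h (Y w, t))%E.
Proof.
move=> mh h0.
transitivity (\int[distribution P YXm]_p h p)%E.
  by rewrite /distribution ge0_integral_pushforward.
transitivity (\int[(distribution P Ym \x D)%E]_p h p)%E.
  by apply: eq_measure_integral => A mA _; exact: joint_law.
rewrite fubini_tonelli1// /distribution ge0_integral_pushforward//=.
  exact: measurable_fun_fubini_tonelli_F.
by move=> w _; apply: integral_ge0.
Qed.

(** Integrability is first transported to the product of the laws; Fubini then integrates over the
    fresh variable first, where the mean is zero. *)
Lemma independent_integral_eq0 (h : W * T -> R) : measurable_fun setT h ->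
  P.-integrable setT (EFin \o (fun w => h (Y w, X w))) ->
  (forall w, \int[D]_t (h (w, t))%:E = 0)%E ->
  \int[P]_w h (Y w, X w) = 0.
Proof.
move=> mh ih h0; have mEh : measurable_fun setT (EFin \o h) by exact/measurable_EFinP.
have iYX : (distribution P YXm).-integrable setT (EFin \o h).
  by rewrite /distribution; apply: integrable_pushforward.
have iprod : (distribution P Ym \x D)%E.-integrable setT (EFin \o h).
  apply/integrableP; split => //.
  have /integrableP[_] := iYX; apply: le_lt_trans.
  rewrite (eq_measure_integral (distribution P YXm))// => A mA _.
  by apply/esym; exact: joint_law.
rewrite /Rintegral -[LHS]/(fine (\int[P]_w ((EFin \o h) (YXm w)))%E).
have <- : (\int[distribution P YXm]_p (EFin \o h) p =
           \int[P]_w (EFin \o h) (YXm w))%E.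
  by rewrite /distribution integral_pushforward.
rewrite (eq_measure_integral (distribution P Ym \x D)%E) => [|A mA _]; last first.
  exact: joint_law.
by rewrite -integral12_prod_meas1// integral0_eq// => w _; exact: h0.
Qed.

End IndependentFubini.

Section LeaveOneOut.
Context {R : realType} {dO dT : measure_display}.
Context {Omega : measurableType dO} {T : measurableType dT}.
Variables (P : probability Omega R) (D : probability T R).
Variables (I : finType) (X : I -> Omega -> T) (i : I).
Hypothesis iidX : iid_sample P D X.

Let mX j : measurable_fun setT (X j). Proof. by have [] := iidX. Qed.

Let mpreX j A : measurable A -> measurable (X j @^-1` A).
Proof. by move=> mA; rewrite -[X in measurable X]setTI; exact: mX. Qed.

(* The "past" of X i is Omega itself with the sigma-algebra generated by this
   pi-system, so that a function of the other samples is just a function that is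
   measurable for that sigma-algebra. *)
Definition other_cylinders : set (set Omega) :=
  [set E | exists A : I -> set T, [/\ forall j, measurable (A j), A i = setT
     & E = \bigcap_(j in [set: I]) (X j @^-1` A j)]].

Definition other_samples := g_sigma_algebraType other_cylinders.

Let P_cylinder (A : I -> set T) : (forall j, measurable (A j)) ->
  (P (\bigcap_(j in [set: I]) (X j @^-1` A j)) = \prod_(j : I) D (A j))%E.
Proof.
move=> mA; have [_ XD indep] := iidX.
have := indep [set: I]%SET A mA.
under eq_bigr do rewrite XD//.
rewrite (_ : [set` [set: I]%SET] = setT); last by apply/seteqP; split=> j //=; rewrite inE.
by move=> ->; apply: eq_bigl => j; rewrite inE.
Qed.

Let cylinder_measurable : other_cylinders `<=` measurable.
Proof.
by move=> E [A [mA _ ->]]; apply: fin_bigcap_measurable => // j _; exact: mpreX.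
Qed.

Lemma measurable_id_other_samples : measurable_fun setT (id : Omega -> other_samples).
Proof.
apply: (@measurability _ _ Omega other_samples setT id other_cylinders erefl).
by move=> _ [E cE <-]; rewrite setTI; exact: cylinder_measurable.
Qed.

(** The witness is a cylinder constraining coordinate [j] alone; since [j != i], coordinate [i]
    stays free. *)
Lemma measurable_other_sample j : j != i ->
  measurable_fun setT (X j : other_samples -> T).
Proof.
move=> ji _ B mB; rewrite setTI; apply: sub_sigma_algebra.
exists (fun k => if k == j then B else setT); split=> [k||].
- by case: ifP.
- by rewrite eq_sym (negbTE ji).
apply/seteqP; split => w /=.
  by move=> Xj k _ /=; case: eqP => [->|].
by move=> /(_ j Logic.I) /=; rewrite eqxx.
Qed.

(** Both sides are finite measures in [A]. They agree on the cylinders, a pi-system generating the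
    sigma-algebra, hence everywhere on it. *)
Lemma other_samples_independent (A : set Omega) (B : set T) :
  <<s other_cylinders>> A -> measurable B ->
  (P (A `&` X i @^-1` B) = P A * D B)%E.
Proof.
move=> sA mB.
have mXB := mpreX i mB.
have DBE : (fine (D B))%:E = D B by rewrite fineK// fin_num_measure.
pose r : {nonneg R} := NngNum (fine_ge0 (measure_ge0 D B)).
rewrite -DBE muleC.
apply: (@g_sigma_algebra_measure_unique _ R Omega other_cylinders
  cylinder_measurable (fun _ => setT) _ _ (mrestr P mXB) (mscale r P)) sA.
- move=> _; exists (fun=> setT); split => //.
  by apply/seteqP; split.
- by apply/seteqP; split => // w _; exists 0.
- move=> E F [A1 [mA1 A1i ->]] [A2 [mA2 A2i ->]].
  exists (fun j => A1 j `&` A2 j); split => [j||].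
  + exact: measurableI.
  + by rewrite A1i A2i setIT.
  + by rewrite -bigcapI; apply: eq_bigcapr.
- move=> _ [A1 [mA1 A1i ->]]; rewrite /= /mrestr /mscale /= DBE.
  (* Slot [i] is unconstrained in [A1], so the event on [X i] can be inserted there and the
     intersection is again a cylinder. *)
  pose A2 j := if j == i then B else A1 j.
  have -> : \bigcap_(j in [set: I]) (X j @^-1` A1 j) `&` X i @^-1` B =
      \bigcap_(j in [set: I]) (X j @^-1` A2 j).
    apply/seteqP; split => w /=.
      by move=> [h hB] j _; rewrite /A2 /=; case: eqP => [->//|_]; exact: h.
    move=> h; split; last by have := h i Logic.I; rewrite /A2 /= eqxx.
    move=> j _; have := h j Logic.I; rewrite /A2 /=; case: eqP => [->|//].
    by rewrite A1i.
  rewrite !P_cylinder// => [|j]; last by rewrite /A2; case: ifP.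
  rewrite (bigD1 i)//= [in RHS](bigD1 i)//= /A2 eqxx A1i probability_setT mul1e.
  by congr (_ * _)%E; apply: eq_bigr => j /negbTE ->.
- by move=> _; rewrite /= /mrestr setTI; apply: le_lt_trans (probability_le1 _ _) (ltry _).
Qed.

End LeaveOneOut.

(** * Measurability of vector operations and of the iterates *)

Section MeasurableVectors.
Context {R : realType} {d : nat} {dW : measure_display} {W : measurableType dW}.
Implicit Types u v : W -> 'rV[R]_d.

Lemma measurable_coords_cst (x : 'rV[R]_d) : measurable_coords (fun _ : W => x).
Proof. by move=> i; exact: measurable_cst. Qed.

Lemma measurable_coordsD u v : measurable_coords u -> measurable_coords v ->
  measurable_coords (fun w => u w + v w).
Proof.
by move=> mu mv i; under eq_fun do rewrite mxE; apply: measurable_funD.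
Qed.

Lemma measurable_coordsZ (a : W -> R) u : measurable_fun setT a ->
  measurable_coords u -> measurable_coords (fun w => a w *: u w).
Proof.
by move=> ma mu i; under eq_fun do rewrite mxE; apply: measurable_funM.
Qed.

Lemma measurable_coordsB u v : measurable_coords u -> measurable_coords v ->
  measurable_coords (fun w => u w - v w).
Proof.
by move=> mu mv i; under eq_fun do rewrite !mxE; apply: measurable_funB.
Qed.

Lemma measurable_coords_sum (I : finType) (u : I -> W -> 'rV[R]_d) :
  (forall i, measurable_coords (u i)) ->
  measurable_coords (fun w => \sum_i u i w).
Proof.
move=> mu j; under eq_fun do rewrite summxE.
by apply: measurable_sum => i; exact: mu.
Qed.

Lemma measurable_dotp u v : measurable_coords u -> measurable_coords v ->
  measurable_fun setT (fun w => dotp (u w) (v w)).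
Proof.
by move=> mu mv; apply: measurable_sum => i; apply: measurable_funM.
Qed.

Lemma measurable_proj_ball r u : measurable_coords u ->
  measurable_coords (fun w => proj_ball r (u w)).
Proof.
move=> mu; apply: measurable_coordsZ => //.
apply: measurable_minr => //; apply: measurable_funM => //.
(* On non-negative reals, 0 included, the inverse equals the power with exponent -1, which is
   measurable. *)
under eq_fun do rewrite -powR_inv1 ?enorm_ge0//.
apply: (measurableT_comp (measurable_powR _)).
apply: measurableT_comp (measurable_dotp mu mu).
by apply: continuous_measurable_fun; exact: sqrt_continuous.
Qed.

End MeasurableVectors.

Section MeasurableIterates.
Context {R : realType} {d B : nat} {dW dT : measure_display}.
Context {W : measurableType dW} {T : measurableType dT}.
Variables (f : 'rV[R]_d -> T -> R) (b : 'rV[R]_d -> 'rV[R]_d).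
Hypothesis mf : forall x, measurable_fun setT (f x).
Hypothesis df : forall t x, differentiable (f^~ t) x.
Hypothesis mb : measurable_fun [set: borel_rV R d] (b : borel_rV R d -> borel_rV R d).

Lemma measurable_bias (u : W -> 'rV[R]_d) : measurable_coords u ->
  measurable_coords (fun w => b (u w)).
Proof.
move=> mu; apply: (@measurable_borel_coords R d _ W (fun w => b (u w))).
exact: (measurableT_comp mb (measurable_coords_borel mu)).
Qed.

(** The source space is arbitrary and only samples with [l < k] must be measurable. Hence the lemma
    serves both for [Omega] and for the coarser sigma-algebra that leaves out one later sample. *)
Lemma measurable_acsa_iter (gamma r : R) (x0 : 'rV[R]_d) (k : nat)
    (z : W -> nat -> 'I_B -> T) :
  (forall l i, (l < k)%N -> measurable_fun setT (fun w => z w l i)) ->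
  let s w := acsa_iter gamma r
    (fun l => batched_oracle (biased_oracle f b) (z w l)) x0 k in
  measurable_coords (fun w => (s w).1) /\ measurable_coords (fun w => (s w).2).
Proof.
elim: k => [|k IH] mz /=; first by split; exact: measurable_coords_cst.
have [|m1 m2] := IH; first by move=> l i /leqW; exact: mz.
have mx : measurable_coords (fun w => proj_ball r
    ((acsa_iter gamma r (fun l => batched_oracle (biased_oracle f b) (z w l)) x0 k).1
     - (gamma * k.+1%:R) *: batched_oracle (biased_oracle f b) (z w k)
      ((acsa_beta k)^-1 *: (acsa_iter gamma r
          (fun l => batched_oracle (biased_oracle f b) (z w l)) x0 k).1
       + (1 - (acsa_beta k)^-1) *: (acsa_iter gamma r
          (fun l => batched_oracle (biased_oracle f b) (z w l)) x0 k).2))).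
  apply: measurable_proj_ball; apply: measurable_coordsB => //.
  apply: measurable_coordsZ => //; apply: measurable_coordsZ => //.
  have mmd := measurable_coordsD
    (measurable_coordsZ (measurable_cst (acsa_beta k)^-1) m1)
    (measurable_coordsZ (measurable_cst (1 - (acsa_beta k)^-1)) m2).
  apply: measurable_coords_sum => i; apply: measurable_coordsD.
    by apply: measurable_grad => //; exact: mz.
  exact: measurable_bias.
split => //=.
by apply: measurable_coordsD; apply: measurable_coordsZ.
Qed.

End MeasurableIterates.

(** * Expectations *)

Section RealIntegrals.
Context {R : realType} {dW : measure_display} {W : measurableType dW}.
Variable P : probability W R.
Implicit Types f g h : W -> R.

Definition Rintegrable f := P.-integrable [set: W] (EFin \o f).

Lemma Rintegrable_measurable f : Rintegrable f -> measurable_fun setT f.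
Proof. by move=> /measurable_int/measurable_EFinP. Qed.

Lemma Rintegrable_cst r : Rintegrable (cst r).
Proof. exact: finite_measure_integrable_cst. Qed.

Lemma RintegrableD f g : Rintegrable f -> Rintegrable g ->
  Rintegrable (fun w => f w + g w).
Proof. by move=> sf sg; exact: (integrableD measurableT sf sg). Qed.

Lemma RintegrableB f g : Rintegrable f -> Rintegrable g ->
  Rintegrable (fun w => f w - g w).
Proof. by move=> sf sg; exact: (integrableB measurableT sf sg). Qed.

Lemma RintegrableZ a f : Rintegrable f -> Rintegrable (fun w => a * f w).
Proof. by move=> sf; exact: (integrableZl measurableT a sf). Qed.

Lemma Rintegrable_sum (I : Type) (s : seq I) (f : I -> W -> R) :
  (forall i, Rintegrable (f i)) -> Rintegrable (fun w => \sum_(i <- s) f i w).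
Proof.
move=> sf; elim: s => [|i s IH].
  by under eq_fun do rewrite big_nil; exact: Rintegrable_cst.
by under eq_fun do rewrite big_cons; exact: RintegrableD.
Qed.

Lemma Rint_cst r : \int[P]_w r = r.
Proof. rewrite Rintegral_cst// [X in fine X](_ : _ = 1%E) ?mulr1//; exact: probability_setT. Qed.

Lemma RintD f g : Rintegrable f -> Rintegrable g ->
  \int[P]_w (f w + g w) = \int[P]_w f w + \int[P]_w g w.
Proof. by move=> sf sg; rewrite RintegralD. Qed.

Lemma RintB f g : Rintegrable f -> Rintegrable g ->
  \int[P]_w (f w - g w) = \int[P]_w f w - \int[P]_w g w.
Proof. by move=> sf sg; rewrite RintegralB. Qed.

Lemma RintZ a f : Rintegrable f -> \int[P]_w (a * f w) = a * \int[P]_w f w.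
Proof. by move=> sf; rewrite RintegralZl. Qed.

Lemma Rint_sum (I : Type) (s : seq I) (f : I -> W -> R) :
  (forall i, Rintegrable (f i)) ->
  \int[P]_w (\sum_(i <- s) f i w) = \sum_(i <- s) \int[P]_w f i w.
Proof.
move=> sf; elim: s => [|i s IH].
  under eq_Rintegral do rewrite big_nil.
  by rewrite big_nil Rint_cst.
under eq_Rintegral do rewrite big_cons.
by rewrite RintD// ?IH ?big_cons//; exact: Rintegrable_sum.
Qed.

Lemma le_Rintegrable f g : measurable_fun setT f -> Rintegrable g ->
  {ae P, forall w, `|f w| <= g w} -> Rintegrable f.
Proof.
move=> mf sg fg; apply/integrableP; split; first exact/measurable_EFinP.
have /integrableP[mg] := sg; apply: le_lt_trans; apply: ae_ge0_le_integral => //.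
- by apply: measurableT_comp => //; exact/measurable_EFinP.
- exact: measurableT_comp.
- by apply: filterS fg => w fw _; rewrite lee_fin (le_trans fw)// ler_norm.
Qed.

Lemma bounded_Rintegrable f r : measurable_fun setT f -> (forall w, `|f w| <= r) ->
  Rintegrable f.
Proof. by move=> mf fr; apply: le_Rintegrable (Rintegrable_cst r) _ => //; exact: aeW. Qed.

Lemma le_Rint f g : Rintegrable f -> Rintegrable g ->
  {ae P, forall w, f w <= g w} -> \int[P]_w f w <= \int[P]_w g w.
Proof.
move=> sf sg fg; rewrite -subr_ge0 -RintB//.
have sgf := RintegrableB sg sf.
(* The difference equals its absolute value almost everywhere, which turns an almost sure inequality
   into a pointwise one. *)
have -> : \int[P]_w (g w - f w) = \int[P]_w `|g w - f w|.
  congr fine; apply: ae_eq_integral => //.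
  - by apply/measurable_EFinP; exact: Rintegrable_measurable.
  - apply/measurable_EFinP; apply: measurableT_comp => //.
    exact: Rintegrable_measurable.
  - by apply: filterS fg => w fw _; rewrite ger0_norm// subr_ge0.
by apply: Rintegral_ge0 => w _.
Qed.

Lemma Rintegrable_dotp {d} (u v : W -> 'rV[R]_d) :
  measurable_coords u -> measurable_coords v ->
  Rintegrable (fun w => dotp (u w) (u w)) ->
  Rintegrable (fun w => dotp (v w) (v w)) ->
  Rintegrable (fun w => dotp (u w) (v w)).
Proof.
move=> mu mv su sv; apply: (le_Rintegrable _ (RintegrableD su sv)).
  exact: measurable_dotp.
apply: aeW => w; have := young (u w) (v w); have := youngN (u w) (v w).
have := dotp_ge0 (u w); have := dotp_ge0 (v w).
by rewrite ler_norml; lra.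
Qed.

Lemma RintegrableE f : Rintegrable f -> (\int[P]_w (f w)%:E = (\int[P]_w f w)%:E)%E.
Proof. by move=> sf; rewrite /Rintegral fineK//; exact: integrable_fin_num. Qed.

End RealIntegrals.

(** * Step size and recursion *)

Section Stepsize.
Context {R : realType}.
Variables (L r sigma : R) (N B : nat).
Hypothesis L0 : 0 < L.
Hypothesis r0 : 0 < r.
Hypothesis sigma0 : 0 <= sigma.
Hypothesis N0 : (0 < N)%N.
Hypothesis B0 : (0 < B)%N.

Local Notation gamma := (acsa_gamma L r sigma N B).

Let Np : 0 < N%:R :> R. Proof. by rewrite ltr0n. Qed.
Let Bp : 0 < B%:R :> R. Proof. by rewrite ltr0n. Qed.

Lemma acsa_gamma_gt0 : 0 < gamma.
Proof.
have g1 : 0 < 1 / (12 * L) by rewrite divr_gt0// mulr_gt0.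
have g2 : 0 < B%:R / (24 * L * N.+1%:R) by rewrite divr_gt0// !mulr_gt0.
rewrite /acsa_gamma; case: eqP => [_|/eqP s0]; rewrite !lt_min g1 g2//=.
have sp : 0 < sigma by rewrite lt_neqAle eq_sym s0.
by rewrite sqrtr_gt0 divr_gt0 ?mulr_gt0 ?exprn_gt0.
Qed.

Lemma acsa_gamma_le_smooth : 12 * L * gamma <= 1.
Proof.
have : gamma <= 1 / (12 * L).
  by rewrite /acsa_gamma; case: ifP => _; rewrite !ge_min lexx.
by rewrite ler_pdivlMr ?mulr_gt0// mulrC.
Qed.

Lemma acsa_gamma_le_batch : 24 * L * N.+1%:R * gamma <= B%:R.
Proof.
have : gamma <= B%:R / (24 * L * N.+1%:R).
  by rewrite /acsa_gamma; case: ifP => _; rewrite !ge_min lexx ?orbT.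
by rewrite ler_pdivlMr ?mulr_gt0// mulrC.
Qed.

Lemma acsa_gamma_le_noise : gamma ^+ 2 * sigma ^+ 2 * N%:R ^+ 3 <= B%:R * r ^+ 2.
Proof.
have [->|s0] := eqVneq sigma 0.
  by rewrite expr0n mulr0 mul0r mulr_ge0// sqr_ge0.
have sN : 0 < sigma ^+ 2 * N%:R ^+ 3.
  have sp : 0 < sigma by rewrite lt_neqAle eq_sym s0.
  by rewrite mulr_gt0 ?exprn_gt0.
have : gamma <= Num.sqrt (B%:R * r ^+ 2 / (sigma ^+ 2 * N%:R ^+ 3)).
  by rewrite /acsa_gamma (negbTE s0) !ge_min lexx orbT.
rewrite -(@ler_pXn2r _ 2) ?nnegrE ?sqrtr_ge0 ?(ltW acsa_gamma_gt0)//.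
rewrite sqr_sqrtr; last by rewrite divr_ge0 ?(ltW sN)// mulr_ge0// sqr_ge0.
by rewrite ler_pdivlMr// mulrA.
Qed.

(** The step size is one of its candidates, and each candidate contributes one term of the
    right-hand side; the other terms are non-negative. *)
Lemma acsa_gamma_inv : r ^+ 2 / (gamma * N%:R ^+ 2) <=
  12 * (L * r ^+ 2 / N%:R ^+ 2) + 48 * (L * r ^+ 2 / (B%:R * N%:R))
  + sigma * r / Num.sqrt (B%:R * N%:R).
Proof.
have [[L1 r1] [N1 B1]] := (ltW L0, ltW r0, (ltW Np, ltW Bp)).
have t1 : 0 <= L * r ^+ 2 / N%:R ^+ 2.
  by rewrite divr_ge0 ?mulr_ge0 ?exprn_ge0.
have t2 : 0 <= L * r ^+ 2 / (B%:R * N%:R).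
  by rewrite divr_ge0 ?mulr_ge0 ?exprn_ge0.
have t3 : 0 <= sigma * r / Num.sqrt (B%:R * N%:R).
  by rewrite divr_ge0 ?mulr_ge0 ?sqrtr_ge0.
have c1 : r ^+ 2 / (1 / (12 * L) * N%:R ^+ 2) = 12 * (L * r ^+ 2 / N%:R ^+ 2).
  by field; rewrite !gt_eqF.
have c2 : r ^+ 2 / (B%:R / (24 * L * N.+1%:R) * N%:R ^+ 2) <=
    48 * (L * r ^+ 2 / (B%:R * N%:R)).
  have -> : r ^+ 2 / (B%:R / (24 * L * N.+1%:R) * N%:R ^+ 2) =
      24 * (N.+1%:R / N%:R) * (L * r ^+ 2 / (B%:R * N%:R)).
    by field; rewrite !gt_eqF.
  apply: ler_wpM2r => //.
  (* This ratio turns the 24 of the batch candidate into 48. *)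
  have : N.+1%:R / N%:R <= 2 :> R.
    by rewrite ler_pdivrMr// -natrM ler_nat mulnC muln2 -addnn -add1n leq_add2r.
  by lra.
have c3 : sigma != 0 -> r ^+ 2 / (Num.sqrt (B%:R * r ^+ 2 / (sigma ^+ 2 * N%:R ^+ 3))
    * N%:R ^+ 2) = sigma * r / Num.sqrt (B%:R * N%:R).
  move=> s0; have sp : 0 < sigma by rewrite lt_neqAle eq_sym s0.
  have BNp : 0 < B%:R * N%:R :> R by rewrite mulr_gt0.
  (* A perfect square is isolated so that the root reduces to [Num.sqrt (B%:R * N%:R)]. *)
  have -> : B%:R * r ^+ 2 / (sigma ^+ 2 * N%:R ^+ 3) =
      (B%:R * N%:R) * (r / (sigma * N%:R ^+ 2)) ^+ 2.
    by field; rewrite !gt_eqF.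
  rewrite (sqrtrM _ (ltW BNp)) sqrtr_sqr ger0_norm; last first.
    by rewrite divr_ge0 ?mulr_ge0 ?exprn_ge0.
  have qp : 0 < Num.sqrt (B%:R * N%:R : R) by rewrite sqrtr_gt0.
  by move: (Num.sqrt _) qp => q qp; field; rewrite !gt_eqF.
rewrite /acsa_gamma; case: eqP => [_|/eqP /c3 {}c3];
  rewrite /Num.min; do ?case: ifP => _; rewrite ?c1 ?c3; lra.
Qed.

End Stepsize.

Section Recursion.
Context {R : realType}.
Variables (L r zeta gamma sigma : R) (N B : nat) (a D : nat -> R).
Hypothesis L0 : 0 < L.
Hypothesis r0 : 0 < r.
Hypothesis zeta0 : 0 <= zeta.
Hypothesis N0 : (0 < N)%N.
Hypothesis B0 : (0 < B)%N.
Hypothesis gamma0 : 0 < gamma.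
Hypothesis gammaL : 12 * L * gamma <= 1.
Hypothesis gammaB : 24 * L * N.+1%:R * gamma <= B%:R.
Hypothesis gamma_sigma : gamma ^+ 2 * sigma ^+ 2 * N%:R ^+ 3 <= B%:R * r ^+ 2.
Hypothesis a0 : forall k, (0 < k)%N -> 0 <= a k.
Hypothesis D0 : forall k, 0 <= D k.
Hypothesis a1 : a 1%N <= 2 * L * r ^+ 2.
Hypothesis D1 : D 1%N <= 4 * r ^+ 2.
Hypothesis step : forall k (gk := gamma * k.+1%:R), (0 < k < N)%N ->
  acsa_beta k * gk * a k.+1 <= (acsa_beta k - 1) * gk * a k
    + D k / 2 - D k.+1 / 2
    + 2 * r * zeta * gk + gk ^+ 2 * (B%:R^-1 * (8 * L * a k +
    (16 * L ^+ 2 * (acsa_beta k)^-1 ^+ 2 * r ^+ 2 + 2 * sigma ^+ 2))).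

(** Error of one step, bounded uniformly: [gk <= gamma * N], and [gk / beta_k <= 6 * gamma] turns
    the factor 16 into [16 * 36 = 576]. *)
Let err := 2 * r * zeta * (gamma * N%:R) +
  B%:R^-1 * (576 * gamma ^+ 2 * L ^+ 2 * r ^+ 2
             + 2 * sigma ^+ 2 * gamma ^+ 2 * N%:R ^+ 2).

Let BV : B%:R^-1 * B%:R = 1 :> R.
Proof. by rewrite mulVf// pnatr_eq0 -lt0n. Qed.

Let BV0 : 0 <= B%:R^-1 :> R. Proof. by rewrite invr_ge0. Qed.

(** The coefficient of [a] at [k + 1] is exactly [beta_k * gk]; the one at [k] exceeds
    [(beta_k - 1) * gk] by [gamma * k * 4 / 6], which pays for the noise proportional to [a k]. *)
Lemma acsa_recursion_invariant k : (0 < k <= N)%N ->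
  gamma * k%:R * (k%:R + 5) / 6 * a k + D k / 2 <=
    gamma * (2 * L * r ^+ 2) + 2 * r ^+ 2 + k%:R * err.
Proof.
have err0 : 0 <= err.
  have [r1 g1] := (ltW r0, ltW gamma0).
  apply: addr_ge0; first by rewrite !mulr_ge0.
  by apply: mulr_ge0 => //; apply: addr_ge0; do ?[exact: sqr_ge0 | apply: mulr_ge0 | done].
elim: k => [//|[_ _|k IH /andP[_ kN]]].
  have := ler_wpM2l (ltW gamma0) a1; have := D1.
  by move: err err0 => e e0; lra.
have {}IH := IH (ltnW kN).
have := step (k := k.+1) kN; rewrite /=.
set gk := gamma * _.
set x := a k.+1 in IH *.
have x0 : 0 <= x by exact: a0.
set bt := acsa_beta _.
have btE : bt = 1 + k.+1%:R / 6 by [].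
have k1 : 1 <= k.+1%:R :> R by rewrite ler1n.
have gkE : gk = gamma * (k.+1%:R + 1) by rewrite /gk -natr1.
have kN' : k.+1%:R + 1 <= N%:R :> R by rewrite natr1 ler_nat.
(* From here [t] is the current index of the recursion, one more than the induction variable. *)
rewrite -[k.+2%:R]natr1; move: (k.+1%:R) => t in btE k1 gkE kN' IH *.
have bt0 : 0 < bt by lra.
have gk0 : 0 <= gk by rewrite gkE mulr_ge0 ?ltW//; lra.
have gkN : gk <= gamma * N%:R by rewrite gkE ler_wpM2l// ltW.
have h1 : gk ^+ 2 * (B%:R^-1 * (8 * L)) <= gk / 3.
  have q : 24 * L * gk <= B%:R.
    apply: le_trans gammaB; rewrite -mulrA -[leRHS]mulrA -mulrA.
    apply: ler_wpM2l => //; apply: ler_wpM2l; first exact: ltW.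
    by rewrite [leRHS]mulrC (le_trans gkN)// ler_wpM2l ?ler_nat// ltW.
  have := ler_wpM2l BV0 q; rewrite BV => /(ler_wpM2l gk0); lra.
have h2 : gk ^+ 2 * (bt^-1 ^+ 2) <= 36 * gamma ^+ 2.
  have -> : 36 * gamma ^+ 2 = (6 * gamma) ^+ 2 by ring.
  have b0 : 0 <= gk * bt^-1 by rewrite mulr_ge0// invr_ge0 ltW.
  rewrite -exprMn ler_pXn2r ?nnegrE// ?mulr_ge0 ?(ltW gamma0)//.
  by rewrite ler_pdivrMr// gkE btE; have := ltW gamma0; lra.
have h3 : gk ^+ 2 <= gamma ^+ 2 * N%:R ^+ 2.
  by rewrite -exprMn ler_pXn2r ?nnegrE// mulr_ge0// ltW.
have rz : 0 <= 2 * r * zeta by rewrite !mulr_ge0// ltW.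
have h4 := ler_wpM2l rz gkN.
have h5 := ler_wpM2r x0 h1.
have e1 : 0 <= B%:R^-1 * (16 * L ^+ 2 * r ^+ 2).
  by do ?[exact: sqr_ge0 | apply: mulr_ge0 | done].
have h6 := ler_wpM2l e1 h2.
have e2 : 0 <= B%:R^-1 * (2 * sigma ^+ 2).
  by do ?[exact: sqr_ge0 | apply: mulr_ge0 | done].
have h7 := ler_wpM2l e2 h3.
(* The cost [gamma * (t + 1) / 3] fits into [gamma * t * 4 / 6] because [t >= 1]. *)
have h8 : gk / 3 * x <= gamma * t * 4 / 6 * x.
  by apply: ler_wpM2r => //; rewrite gkE; have := ltW gamma0; nra.
move=> st.
have -> : gk * (t + 1 + 5) / 6 = bt * gk by rewrite btE gkE; field.
apply: le_trans (_ : gamma * t * (t + 5) / 6 * x + D k.+1 / 2 + err <= _); last first.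
  by move: err err0 IH => e _ IH; lra.
rewrite /err.
have -> : gamma * t * (t + 5) / 6 * x = (bt - 1) * gk * x + gamma * t * 4 / 6 * x.
  by rewrite btE gkE; field.
by lra.
Qed.

(** The invariant at [N] is multiplied by 6, dropping the distance and the linear part of
    [N * (N + 5)]. The initial value costs at most 13 times [r ^+ 2], the curvature and variance
    parts of the error at most 12 times each, which fits into 42. *)
Lemma acsa_recursion :
  gamma * N%:R ^+ 2 * a N <= 42 * r ^+ 2 + 12 * r * zeta * (gamma * N%:R ^+ 2).
Proof.
have := acsa_recursion_invariant (k := N); rewrite N0 leqnn => /(_ isT).
rewrite /err; have aN := a0 N0; have DN := D0 N.
have n0 : 0 <= N%:R :> R by [].
have [g0 L1] := (ltW gamma0, ltW L0).
have u1 : B%:R^-1 * (24 * L * N%:R * gamma) <= 1.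
  rewrite -[leRHS]BV; apply: ler_wpM2l => //; apply: le_trans gammaB.
  by apply: ler_wpM2r => //; apply: ler_wpM2l; rewrite ?ler_nat// mulr_ge0.
have u2 := ler_wpM2l BV0 gamma_sigma; rewrite [leRHS]mulrA BV mul1r in u2.
have u3 := ler_wpM2r (sqr_ge0 r) gammaL.
have w0 : 0 <= gamma * L * r ^+ 2 by rewrite mulr_ge0 ?sqr_ge0// mulr_ge0.
have u4 := ler_wpM2r w0 u1.
have u5 : 0 <= gamma * N%:R * a N by rewrite !mulr_ge0.
by lra.
Qed.


End Recursion.

(** * The stochastic objective and the iterates *)

Section StochasticObjective.
Context {R : realType} {d : nat} {dT : measure_display} {T : measurableType dT}.
Variables (D : probability T R) (f : 'rV[R]_d -> T -> R) (L : R).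
Variable xs : 'rV[R]_d.
Hypothesis L0 : 0 < L.
Hypothesis sf : forall x, Rintegrable D (f x).
Hypothesis df : forall z x, differentiable (f^~ z) x.

Local Notation g x z := (grad (f^~ z) x).
Local Notation F := (objective D f).

Hypothesis ae_convex : {ae D, forall z, forall x y,
  f x z + dotp (g x z) (y - x) <= f y z}.
Hypothesis ae_smooth : {ae D, forall z, forall x y,
  f y z <= f x z + dotp (g x z) (y - x) + L / 2 * dotp (y - x) (y - x)}.

(** Taking the mean of the sample gradients as gradient field of [F] lets the model inequalities be
    integrated as they stand, without differentiating under the integral. *)
Definition mean_grad x : 'rV[R]_d := \row_i \int[D]_z g x z 0 i.

Lemma measurable_sample_grad x : measurable_coords (fun z => g x z).
Proof.
apply: (@measurable_grad R d _ _ T T f (fun=> x) id) => //.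
  by move=> y; exact: Rintegrable_measurable.
Qed.

Lemma objectiveE x : F x = \int[D]_z f x z.
Proof. by rewrite /objective unlock. Qed.

(** Convexity at [x + e] and [x - e] traps the partial derivative between two integrable differences
    of [f]. *)
Lemma Rintegrable_sample_grad x i : Rintegrable D (fun z => g x z 0 i).
Proof.
pose e : 'rV[R]_d := delta_mx 0 i.
apply: (@le_Rintegrable _ _ _ _ _
  (fun z => `|f (x + e) z - f x z| + `|f (x - e) z - f x z|)).
- exact: measurable_sample_grad.
- by apply: RintegrableD; apply: integrable_norm => //; exact: RintegrableB.
apply: filterS ae_convex => z fc.
have := fc x (x + e); have := fc x (x - e).
rewrite ![x + _ - x]addrC !addKr dotpNr dotp_delta => h1 h2.
have := ler_norm (f (x + e) z - f x z); have := ler_norm (f (x - e) z - f x z).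
have := normr_ge0 (f (x + e) z - f x z); have := normr_ge0 (f (x - e) z - f x z).
by rewrite ler_norml; lra.
Qed.

Lemma Rintegrable_dotp_sample_grad x v : Rintegrable D (fun z => dotp (g x z) v).
Proof.
apply: Rintegrable_sum => i; under eq_fun do rewrite mulrC.
exact/RintegrableZ/Rintegrable_sample_grad.
Qed.

Lemma dotp_mean_grad x v : \int[D]_z dotp (g x z) v = dotp (mean_grad x) v.
Proof.
rewrite Rint_sum => [|i]; last first.
  under eq_fun do rewrite mulrC; exact/RintegrableZ/Rintegrable_sample_grad.
apply: eq_bigr => i _; rewrite mxE mulrC -RintZ; last exact: Rintegrable_sample_grad.
by apply: eq_Rintegral => z _; rewrite mulrC.
Qed.

Lemma objective_convex x y : F x + dotp (mean_grad x) (y - x) <= F y.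
Proof.
rewrite !objectiveE -dotp_mean_grad -RintD//; last exact: Rintegrable_dotp_sample_grad.
apply: le_Rint => //; first by apply: RintegrableD => //; exact: Rintegrable_dotp_sample_grad.
exact: filterS ae_convex.
Qed.

Lemma objective_smooth x y :
  F y <= F x + dotp (mean_grad x) (y - x) + L / 2 * dotp (y - x) (y - x).
Proof.
have s1 := Rintegrable_dotp_sample_grad x (y - x).
rewrite !objectiveE -dotp_mean_grad -RintD//.
rewrite -[X in _ <= _ + X](Rint_cst D) -RintD//.
- apply: le_Rint => //; last exact: filterS ae_smooth.
  by apply: RintegrableD; [exact: RintegrableD|exact: Rintegrable_cst].
- exact: RintegrableD.
- exact: Rintegrable_cst.
Qed.

Hypothesis Fmin : forall x, F xs <= F x.
Variable sigma : R.
Hypothesis var_xs : ('E_D[fun z => (enorm (g xs z - grad F xs) ^+ 2)%R]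
     <= (sigma ^+ 2)%:E)%E.

(** [grad F xs] vanishes, so the variance bound is a bound on the second moment of the sample
    gradient, and its finiteness gives integrability. *)
Lemma Rintegrable_sqr_grad_argmin :
  Rintegrable D (fun z => dotp (g xs z) (g xs z)) /\
  \int[D]_z dotp (g xs z) (g xs z) <= sigma ^+ 2.
Proof.
move: var_xs; rewrite unlock.
rewrite (@grad_argmin_eq0 R d L F mean_grad xs L0 objective_smooth Fmin).
under eq_integral do rewrite subr0 enormK.
move=> le_s; have sg : Rintegrable D (fun z => dotp (g xs z) (g xs z)).
  apply/integrableP; split.
    by apply/measurable_EFinP; apply: measurable_dotp; exact: measurable_sample_grad.
  under eq_integral do rewrite /= ger0_norm ?dotp_ge0//.
  exact: le_lt_trans le_s (ltry _).
by split => //; move: le_s; rewrite RintegrableE// lee_fin.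
Qed.

Lemma grad_variance x :
  let v z := dotp (g x z - mean_grad x) (g x z - mean_grad x) in
  Rintegrable D v /\ \int[D]_z v z <= 4 * L * (F x - F xs) + 2 * sigma ^+ 2.
Proof.
move=> v; have [s1 le_s] := Rintegrable_sqr_grad_argmin.
have G0 : mean_grad xs = 0 := gradient_argmin_eq0 L0 objective_smooth Fmin.
(* The majorant comes from [|g x|^2 <= 2 |g x - g xs|^2 + 2 |g xs|^2], with cocoercivity on the
   first term. Its last bracket completes the centred square and has integral
   [- dotp (mean_grad x) (mean_grad x)]. *)
pose w z := 4 * L * (f x z - f xs z - dotp (g xs z) (x - xs)) +
  2 * dotp (g xs z) (g xs z) +
  (dotp (mean_grad x) (mean_grad x) - 2 * dotp (g x z) (mean_grad x)).
have sd y u : Rintegrable D (fun z => dotp (g y z) u).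
  exact: Rintegrable_dotp_sample_grad.
have sB : Rintegrable D (fun z => f x z - f xs z) by exact: RintegrableB.
have sBB : Rintegrable D (fun z => f x z - f xs z - dotp (g xs z) (x - xs)).
  by apply: RintegrableB.
have sw1 := RintegrableZ (4 * L) sBB.
have sw2 := RintegrableZ 2 s1.
have sc := Rintegrable_cst D (dotp (mean_grad x) (mean_grad x)).
have sw3 := RintegrableB sc (RintegrableZ 2 (sd x (mean_grad x))).
have sw12 := RintegrableD sw1 sw2.
have sw : Rintegrable D w by exact: RintegrableD sw12 sw3.
have vw : {ae D, forall z, v z <= w z}.
  apply: filterS2 ae_convex ae_smooth => z fc fs.
  have := cocoercive L0 fc fs x xs.
  have := dotp_ge0 (g x z - 2 *: g xs z).
  by rewrite /v /w !dotpE (dotpC (g xs z) (g x z)) (dotpC (mean_grad x) (g x z)); lra.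
have sv : Rintegrable D v.
  apply: le_Rintegrable sw _.
    by apply: measurable_dotp; apply: measurable_coordsB;
      (exact: measurable_sample_grad || exact: measurable_coords_cst).
  by apply: filterS vw => z vz; rewrite ger0_norm// dotp_ge0.
split=> //; apply: le_trans (le_Rint sv sw vw) _.
rewrite (RintD sw12 sw3) (RintD sw1 sw2) (RintZ _ sBB) (RintZ _ s1).
rewrite (RintB sB (sd _ _)) (RintB (sf _) (sf _)).
rewrite (RintB sc (RintegrableZ _ (sd _ _))) (RintZ _ (sd _ _)) Rint_cst.
rewrite !dotp_mean_grad G0 (dotpC 0) dotp0r -!objectiveE.
by have := dotp_ge0 (mean_grad x); lra.
Qed.


Let mf x : measurable_fun setT (f x). Proof. exact: Rintegrable_measurable. Qed.

Section MeasurableMeans.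
Context {dW : measure_display} {W : measurableType dW}.
Variable u : W -> 'rV[R]_d.
Hypothesis mu : measurable_coords u.

Let mu1 : measurable_coords (fun p : W * T => u p.1).
Proof. by move=> i; exact: (measurableT_comp (mu i) measurable_fst). Qed.

Lemma measurable_grad_pair :
  measurable_coords (fun p : W * T => g (u p.1) p.2).
Proof. exact: (measurable_grad mf mu1 measurable_snd df). Qed.

Lemma measurable_mean_grad : measurable_coords (fun w => mean_grad (u w)).
Proof.
move=> i; under eq_fun do rewrite mxE.
exact: (measurable_fine_integral D (measurable_grad_pair i)).
Qed.

Lemma measurable_objective : measurable_fun setT (fun w => F (u w)).
Proof.
under eq_fun do rewrite objectiveE.
apply: (measurable_fine_integral D (h := fun p => f (u p.1) p.2)).
apply: (measurable_caratheodory mf mu1 measurable_snd) => t x.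
exact: differentiable_continuous.
Qed.

End MeasurableMeans.

(** * Noise of one sample and of a batch *)

Section SampleNoise.
Context {dO : measure_display} {Omega : measurableType dO}.
Variables (P : probability Omega R) (I : finType) (X : I -> Omega -> T).
Hypothesis iidX : iid_sample P D X.

Let mX j : measurable_fun setT (X j). Proof. by have [] := iidX. Qed.

Definition sample_noise (u : Omega -> 'rV[R]_d) i w :=
  g (u w) (X i w) - mean_grad (u w).

Definition noise_bound x := 4 * L * (F x - F xs) + 2 * sigma ^+ 2.

(** The ascription replaces the sigma-algebra of [Omega] by the one generated by the samples other
    than [i]. *)
Definition other_measurable i (u : Omega -> 'rV[R]_d) :=
  measurable_coords (u : other_samples X i -> 'rV[R]_d).

Lemma other_measurable_full i u : other_measurable i u -> measurable_coords u.
Proof.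
move=> mu j.
exact: (measurableT_comp (mu j) (measurable_id_other_samples iidX)).
Qed.

Lemma sample_noise_other i j u : j != i -> other_measurable i u ->
  other_measurable i (sample_noise u j).
Proof.
move=> ji mu; apply: measurable_coordsB; last exact: measurable_mean_grad.
apply: (measurable_grad mf mu _ df); exact: measurable_other_sample.
Qed.

Lemma measurable_sample_noise i u : measurable_coords u ->
  measurable_coords (sample_noise u i).
Proof.
move=> mu; apply: measurable_coordsB; last exact: measurable_mean_grad.
exact: (measurable_grad mf mu (mX i) df).
Qed.

Section OneSample.
Variables (i : I) (u : Omega -> 'rV[R]_d).
Hypothesis mu : other_measurable i u.

Let pair_noise (p : other_samples X i * T) := g (u p.1) p.2 - mean_grad (u p.1).

Let mpair : measurable_coords pair_noise.
Proof.
apply: measurable_coordsB; first exact: measurable_grad_pair.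
move=> j; exact: (measurableT_comp (measurable_mean_grad mu j) measurable_fst).
Qed.

Let indep A B : measurable (A : set (other_samples X i)) -> measurable B ->
  (P (id @^-1` A `&` X i @^-1` B) = P (id @^-1` A) * D B)%E.
Proof. exact: (other_samples_independent iidX). Qed.

(** Tonelli freezes [u] and integrates over the sample alone, where [grad_variance] applies
    pointwise. *)
Lemma sample_noise_variance : Rintegrable P (fun w => noise_bound (u w)) ->
  Rintegrable P (fun w => dotp (sample_noise u i w) (sample_noise u i w)) /\
  \int[P]_w dotp (sample_noise u i w) (sample_noise u i w) <=
    \int[P]_w noise_bound (u w).
Proof.
move=> sV.
have mu' := other_measurable_full mu.
pose h (p : other_samples X i * T) := dotp (pair_noise p) (pair_noise p).
have mh : measurable_fun setT h by exact: measurable_dotp.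
have hE : (\int[P]_w (dotp (sample_noise u i w) (sample_noise u i w))%:E =
    \int[P]_w \int[D]_t (h (w, t))%:E)%E.
  apply: (ge0_independent_integral (measurable_id_other_samples iidX) (mX i)
    indep (h := EFin \o h)).
    exact/measurable_EFinP.
  by move=> p; rewrite lee_fin dotp_ge0.
have le_h : (\int[P]_w (dotp (sample_noise u i w) (sample_noise u i w))%:E <=
    (\int[P]_w noise_bound (u w))%:E)%E.
  rewrite hE -RintegrableE//; apply: ge0_le_integral => //.
  - by move=> w _; apply: integral_ge0 => t _; rewrite lee_fin dotp_ge0.
  - have -> : (fun w => \int[D]_t (h (w, t))%:E)%E =
        EFin \o (fun w => \int[D]_t h (w, t)).
      apply/funext => w /=; have [sv _] := grad_variance (u w).
      by rewrite RintegrableE.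
    apply/measurable_EFinP; apply: (@measurable_fine_integral _ _ _ Omega T).
    have mp : measurable_coords
        (fun p : Omega * T => g (u p.1) p.2 - mean_grad (u p.1)).
      apply: measurable_coordsB; first exact: measurable_grad_pair.
      by move=> j; exact: (measurableT_comp (measurable_mean_grad mu' j) measurable_fst).
    exact: (measurable_dotp mp mp).
  - by apply/measurable_EFinP; exact: (Rintegrable_measurable sV).
  - move=> w _; have [sv le_v] := grad_variance (u w).
    by rewrite RintegrableE// lee_fin.
have sn : Rintegrable P (fun w => dotp (sample_noise u i w) (sample_noise u i w)).
  apply/integrableP; split.
    apply/measurable_EFinP.
    by apply: measurable_dotp; exact: measurable_sample_noise.
  under eq_integral do rewrite /= ger0_norm ?dotp_ge0//.
  exact: le_lt_trans le_h (ltry _).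
by split => //; rewrite -lee_fin -(RintegrableE sn).
Qed.

(** With [u] and [v] frozen, the sample noise has mean zero. *)
Lemma sample_noise_orthogonal (v : Omega -> 'rV[R]_d) : other_measurable i v ->
  Rintegrable P (fun w => dotp (sample_noise u i w) (v w)) ->
  \int[P]_w dotp (sample_noise u i w) (v w) = 0.
Proof.
move=> mv sv.
apply: (independent_integral_eq0 (measurable_id_other_samples iidX) (mX i)
    indep (h := fun p => dotp (pair_noise p) (v p.1))) => //.
  apply: measurable_dotp => // j.
  exact: (measurableT_comp (mv j) measurable_fst).
move=> w; under eq_integral do rewrite /pair_noise /= dotpDl dotpNl.
rewrite RintegrableE; last first.
  apply: RintegrableB; [exact: Rintegrable_dotp_sample_grad|exact: Rintegrable_cst].
rewrite RintB ?Rint_cst; last 2 first.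
- exact: Rintegrable_dotp_sample_grad.
- exact: Rintegrable_cst.
by rewrite dotp_mean_grad subrr.
Qed.

End OneSample.

Section Batch.
Variables (B : nat) (kappa : 'I_B -> I) (u v : Omega -> 'rV[R]_d).
Hypothesis B0 : (0 < B)%N.
Hypothesis kappa_inj : injective kappa.
Hypothesis mu : forall j, other_measurable (kappa j) u.
Hypothesis mv : forall j, other_measurable (kappa j) v.
Hypothesis su : Rintegrable P (fun w => noise_bound (u w)).
Hypothesis sv : Rintegrable P (fun w => dotp (v w) (v w)).

Let Y j := sample_noise u (kappa j).

Definition batch_noise w := B%:R^-1 *: \sum_j Y j w.

Let mY j : measurable_coords (Y j).
Proof. exact: (measurable_sample_noise _ (other_measurable_full (@mu j))). Qed.

Let sY j : Rintegrable P (fun w => dotp (Y j w) (Y j w)).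
Proof. by have [] := sample_noise_variance (@mu j) su. Qed.

Let sYv j : Rintegrable P (fun w => dotp (Y j w) (v w)).
Proof.
apply: Rintegrable_dotp => //; exact: other_measurable_full (@mv j).
Qed.

Let sYY i j : Rintegrable P (fun w => dotp (Y i w) (Y j w)).
Proof. exact: Rintegrable_dotp. Qed.

Lemma batch_noise_orthogonal :
  Rintegrable P (fun w => dotp (batch_noise w) (v w)) /\
  \int[P]_w dotp (batch_noise w) (v w) = 0.
Proof.
have E w : dotp (batch_noise w) (v w) = B%:R^-1 * \sum_j dotp (Y j w) (v w).
  by rewrite dotpZl dotp_suml.
have sS : Rintegrable P (fun w => \sum_j dotp (Y j w) (v w)).
  exact: Rintegrable_sum.
under eq_fun do rewrite E.
split; first exact: RintegrableZ.
rewrite RintZ// Rint_sum// big1 ?mulr0// => j _.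
by apply: sample_noise_orthogonal; [exact: mu|exact: mv|exact: sYv].
Qed.

(** For [j != i], the noise of sample [j] is a function of the samples other than [i], so cross
    terms vanish. The [B] diagonal terms cancel one of the two factors [B%:R^-1]. *)
Lemma batch_noise_variance :
  Rintegrable P (fun w => dotp (batch_noise w) (batch_noise w)) /\
  \int[P]_w dotp (batch_noise w) (batch_noise w) <=
    B%:R^-1 * \int[P]_w noise_bound (u w).
Proof.
have E w : dotp (batch_noise w) (batch_noise w) =
    B%:R^-1 * (B%:R^-1 * \sum_i \sum_j dotp (Y i w) (Y j w)).
  rewrite dotpZl dotpZr dotp_suml; congr (_ * (_ * _)); apply: eq_bigr => i _.
  by rewrite dotp_sumr.
have sS : Rintegrable P (fun w => \sum_i \sum_j dotp (Y i w) (Y j w)).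
  by apply: Rintegrable_sum => i; exact: Rintegrable_sum.
under eq_fun do rewrite E.
split; first exact/RintegrableZ/RintegrableZ.
rewrite RintZ; last exact: RintegrableZ.
rewrite RintZ// ler_pM2l ?invr_gt0 ?ltr0n//.
rewrite ler_pdivrMl ?ltr0n// Rint_sum => [|i]; last exact: Rintegrable_sum.
rewrite -[B in B%:R]card_ord mulr_natl -sumr_const; apply: ler_sum => i _.
rewrite Rint_sum// (bigD1 i)//= big1 ?addr0 => [|j ji].
  by have [] := sample_noise_variance (@mu i) su.
apply: sample_noise_orthogonal; [exact: mu| |exact: sYY].
by apply: sample_noise_other; [rewrite (inj_eq kappa_inj)|exact: mu].
Qed.

End Batch.
End SampleNoise.

(** * Expected descent along the iterates *)

Section Iterates.
Variables (b : 'rV[R]_d -> 'rV[R]_d) (r zeta gamma : R) (x0 : 'rV[R]_d) (N B : nat).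
Context {dO : measure_display} {Omega : measurableType dO}.
Variables (P : probability Omega R) (xi : nat -> 'I_B -> Omega -> T).
Hypothesis mb : measurable_fun [set: borel_rV R d] (b : borel_rV R d -> borel_rV R d).
Hypothesis b_le : forall x, enorm (b x) <= zeta.
Hypothesis r0 : 0 < r.
Hypothesis xsr : enorm xs <= r.
Hypothesis B0 : (0 < B)%N.
Hypothesis iid_xi : iid_sample P D (fun j : 'I_N * 'I_B => xi j.1 j.2).
Hypothesis gamma0 : 0 < gamma.
Hypothesis gammaL : 12 * L * gamma <= 1.
Hypothesis gammaB : 24 * L * N.+1%:R * gamma <= B%:R.
Hypothesis gamma_sigma : gamma ^+ 2 * sigma ^+ 2 * N%:R ^+ 3 <= B%:R * r ^+ 2.

Let oracle w l := batched_oracle (biased_oracle f b) (fun i => xi l i w).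
Let s k w := acsa_iter gamma r (oracle w) x0 k.
Let beta k : R := acsa_beta k.
Let md k w := (beta k)^-1 *: (s k w).1 + (1 - (beta k)^-1) *: (s k w).2.
Let phi k w := F (s k w).2 - F xs.
Let dist k w := dotp ((s k w).1 - xs) ((s k w).1 - xs).

Let beta_ge1 k : 1 <= beta k.
Proof. by rewrite /beta /acsa_beta lerDl divr_ge0. Qed.

Let betaV k : 0 <= (beta k)^-1 <= 1.
Proof.
by rewrite invr_ge0 (le_trans ler01)//= invf_le1// (lt_le_trans ltr01).
Qed.

Lemma acsa_iter_ball k w : (0 < k)%N -> enorm (s k w).1 <= r /\ enorm (s k w).2 <= r.
Proof.
elim: k => [//|k IH] _; rewrite /s /=; split; first exact: enorm_proj_ball.
case: k IH => [_|k /(_ isT)[_ IH]].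
  (* The first weight is 1, so the first average equals the projected point and [x0] drops out. *)
  have -> : acsa_beta 0 = 1 :> R by rewrite /acsa_beta mul0r addr0.
  rewrite invr1 scale1r subrr scale0r addr0.
  exact: enorm_proj_ball.
by apply: enorm_convex => //; exact: enorm_proj_ball.
Qed.

Lemma acsa_md_ball k w : (0 < k)%N -> enorm (md k w) <= r.
Proof. by move=> /(acsa_iter_ball w)[s1 s2]; exact: enorm_convex. Qed.

(** The state before step [k] reads samples of steps [l < k] only, and [(k, j)] is none of them. *)
Lemma acsa_iter_other (k : 'I_N) (j : 'I_B) :
  other_measurable (fun j : 'I_N * 'I_B => xi j.1 j.2) (k, j) (fun w => (s k w).1) /\
  other_measurable (fun j : 'I_N * 'I_B => xi j.1 j.2) (k, j) (fun w => (s k w).2).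
Proof.
apply: (@measurable_acsa_iter R d B _ _
  (other_samples (fun j : 'I_N * 'I_B => xi j.1 j.2) (k, j)) T f b mf df mb
  gamma r x0 k (fun w l i => xi l i w)) => l i lk.
have lN := ltn_trans lk (ltn_ord k).
apply: (@measurable_other_sample _ _ _ _ _ (fun j : 'I_N * 'I_B => xi j.1 j.2)
  (k, j) (Ordinal lN, i)).
by apply/eqP => -[kl _]; rewrite -kl /= ltnn in lk.
Qed.

Lemma measurable_acsa_state k : (k <= N)%N ->
  measurable_coords (fun w => (s k w).1) /\ measurable_coords (fun w => (s k w).2).
Proof.
move=> kN; apply: (@measurable_acsa_iter R d B _ _ Omega T f b mf df mb
  gamma r x0 k (fun w l i => xi l i w)) => l i lk.
have [mxi _ _] := iid_xi.
exact: (mxi (Ordinal (leq_trans lk kN), i)).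
Qed.

(** A bound valid for every realization; it yields integrability of the gaps and the starting value
    of the recursion. *)
Lemma phi_bound k w : (0 < k)%N -> 0 <= phi k w <= 2 * L * r ^+ 2.
Proof.
move=> /(acsa_iter_ball w)[_ s2]; rewrite subr_ge0 Fmin /=.
exact: (smooth_gap_le L0 objective_smooth Fmin).
Qed.

Lemma Rintegrable_phi k : (0 < k <= N)%N -> Rintegrable P (phi k).
Proof.
move=> /andP[k0 /measurable_acsa_state[_ m2]].
apply: (@bounded_Rintegrable _ _ _ _ _ (2 * L * r ^+ 2)) => [|w].
  by apply: measurable_funB => //; exact: measurable_objective.
by have /andP[p0 pr] := phi_bound w k0; rewrite ger0_norm.
Qed.

Lemma Rintegrable_dist k : (0 < k <= N)%N -> Rintegrable P (dist k).
Proof.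
move=> /andP[k0 /measurable_acsa_state[m1 _]].
apply: (@bounded_Rintegrable _ _ _ _ _ (4 * r ^+ 2)) => [|w].
  by apply: measurable_dotp; apply: measurable_coordsB => //; exact: measurable_coords_cst.
have [s1 _] := acsa_iter_ball w k0.
by rewrite ger0_norm ?dotp_ge0//; exact: dotpB_le_sqr.
Qed.

Lemma batched_oracleE (k : 'I_N) w :
  oracle w k (md k w) = mean_grad (md k w) + b (md k w) +
    batch_noise (fun j : 'I_N * 'I_B => xi j.1 j.2) (fun j => (k, j)) (md k) w.
Proof.
have nB : B%:R != 0 :> R by rewrite pnatr_eq0 -lt0n.
rewrite /batch_noise /oracle /batched_oracle /sample_noise /biased_oracle /=.
set m := md k w; set G := mean_grad m.
have -> : \sum_(i < B) (grad (f^~ (xi k i w)) m + b m) =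
    \sum_(i < B) (grad (f^~ (xi k i w)) m - G) + B%:R *: (G + b m).
  rewrite scaler_nat -[X in _ *+ X]card_ord -sumr_const -big_split /=.
  by apply: eq_bigr => i _; rewrite addrA subrK.
by rewrite scalerDr scalerA mulVf// scale1r addrC.
Qed.


Let X (j : 'I_N * 'I_B) := xi j.1 j.2.

Lemma acsa_md_other (k : 'I_N) j : other_measurable X (k, j) (md k).
Proof.
have [m1 m2] := acsa_iter_other k j.
by apply: measurable_coordsD; apply: measurable_coordsZ.
Qed.

Lemma Rintegrable_noise_bound (k : 'I_N) : (0 < k)%N ->
  Rintegrable P (fun w => noise_bound (md k w)).
Proof.
move=> k0; have [m1 m2] := measurable_acsa_state (ltnW (ltn_ord k)).
apply: RintegrableD; last exact: Rintegrable_cst.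
apply: RintegrableZ.
apply: (@bounded_Rintegrable _ _ _ _ _ (2 * L * r ^+ 2)) => [|w].
  apply: measurable_funB => //; apply: measurable_objective.
  by apply: measurable_coordsD; apply: measurable_coordsZ.
rewrite ger0_norm ?subr_ge0 ?Fmin//.
exact: (smooth_gap_le L0 objective_smooth Fmin (acsa_md_ball w k0)).
Qed.

(** [extrapolation_gap_le] with [c = (beta k)^-1], multiplied by the [4 * L] of the variance
    bound. *)
Lemma expected_noise_bound (k : 'I_N) : (0 < k)%N ->
  \int[P]_w noise_bound (md k w) <= 8 * L * \int[P]_w phi k w +
    (16 * L ^+ 2 * (beta k)^-1 ^+ 2 * r ^+ 2 + 2 * sigma ^+ 2).
Proof.
move=> k0; have sp : Rintegrable P (phi k).
  by apply: Rintegrable_phi; rewrite k0 ltnW.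
rewrite -RintZ// -[X in _ <= _ + X](Rint_cst P) -RintD; last 2 first.
- exact: RintegrableZ.
- exact: Rintegrable_cst.
apply: le_Rint; first exact: Rintegrable_noise_bound.
  by apply: RintegrableD; [exact: RintegrableZ|exact: Rintegrable_cst].
apply: aeW => w; have [s1 s2] := acsa_iter_ball w k0.
have := extrapolation_gap_le L0 objective_smooth Fmin (beta k)^-1 s1 s2.
rewrite -/(md k w) -/(phi k w) /noise_bound => /(ler_wpM2l (ltW L0)).
by lra.
Qed.

Lemma expected_descent (k : 'I_N) (gk := gamma * k.+1%:R) : (0 < k)%N ->
  beta k * gk * \int[P]_w phi k.+1 w <= (beta k - 1) * gk * \int[P]_w phi k w
    + (\int[P]_w dist k w) / 2 - (\int[P]_w dist k.+1 w) / 2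
    + 2 * r * zeta * gk + gk ^+ 2 * (B%:R^-1 * (8 * L * \int[P]_w phi k w +
    (16 * L ^+ 2 * (beta k)^-1 ^+ 2 * r ^+ 2 + 2 * sigma ^+ 2))).
Proof.
move=> k0.
have kN : (0 < k <= N)%N by rewrite k0 ltnW.
have k1N : (0 < k.+1 <= N)%N by rewrite ltn_ord.
have inj_k : injective (fun j : 'I_B => (k, j)) by move=> i j [].
have mu j : other_measurable X (k, j) (md k) by exact: acsa_md_other.
have mv j : other_measurable X (k, j) (fun w => (s k w).1 - xs).
  have [m1 _] := acsa_iter_other k j.
  by apply: measurable_coordsB => //; exact: measurable_coords_cst.
have su := Rintegrable_noise_bound k0.
have sd := Rintegrable_dist kN; have sd1 := Rintegrable_dist k1N.
have sp := Rintegrable_phi kN; have sp1 := Rintegrable_phi k1N.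
pose n := batch_noise X (fun j => (k, j)) (md k).
(* The mean-zero term: both [md k] and [x_k - xs] are functions of samples other than those of step
   [k]. *)
have [snv nv0] := batch_noise_orthogonal iid_xi mu mv su sd.
have [snn le_nn] := batch_noise_variance iid_xi B0 inj_k mu su.
pose nn w := dotp (n w) (n w); pose nv w := dotp (n w) ((s k w).1 - xs).
have s1 := RintegrableZ ((beta k - 1) * gk) sp.
have s2 := RintegrableB (RintegrableZ 2^-1 sd) (RintegrableZ 2^-1 sd1).
have s3 : Rintegrable P (fun w => gk ^+ 2 * nn w - gk * nv w).
  exact: RintegrableB (RintegrableZ _ snn) (RintegrableZ _ snv).
have s4 := RintegrableD (Rintegrable_cst P (2 * r * zeta * gk)) s3.
have s5 := RintegrableD s2 s4.
have le_path : {ae P, forall w, beta k * gk * phi k.+1 w <=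
    (beta k - 1) * gk * phi k w + (2^-1 * dist k w - 2^-1 * dist k.+1 w +
    (2 * r * zeta * gk + (gk ^+ 2 * nn w - gk * nv w)))}.
  apply: aeW => w.
  have := acsa_descent (s := s k w) objective_convex objective_smooth r0
    (ltW gamma0) gammaL xsr (batched_oracleE k w) (b_le _).
  rewrite -/(s k.+1 w) -/(n w) -/(nn w) -/(nv w) -/gk -/(dist k w).
  by rewrite -/(dist k.+1 w) -/(phi k w) -/(phi k.+1 w) -/(beta k); lra.
have := le_Rint (RintegrableZ (beta k * gk) sp1) (RintegrableD s1 s5) le_path.
rewrite (RintD s1 s5) (RintD s2 s4) (RintD (Rintegrable_cst P _) s3).
rewrite (RintB (RintegrableZ _ snn) (RintegrableZ _ snv)).
rewrite (RintB (RintegrableZ _ sd) (RintegrableZ _ sd1)).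
rewrite (RintZ _ sp1) (RintZ _ sp) (RintZ _ sd) (RintZ _ sd1).
rewrite (RintZ _ snn) (RintZ _ snv) Rint_cst nv0.
have BV : 0 <= B%:R^-1 :> R by rewrite invr_ge0.
have := ler_wpM2l (sqr_ge0 gk) (le_trans le_nn (ler_wpM2l BV (expected_noise_bound k0))).
by lra.
Qed.


Lemma expected_gap : (0 < N)%N ->
  Rintegrable P (phi N) /\
  gamma * N%:R ^+ 2 * \int[P]_w phi N w <=
    42 * r ^+ 2 + 12 * r * zeta * (gamma * N%:R ^+ 2).
Proof.
move=> N0; have N01 : (0 < 1 <= N)%N by [].
split; first by apply: Rintegrable_phi; rewrite N0 leqnn.
apply: (acsa_recursion (D := fun k => \int[P]_w dist k w) L0 r0 _ N0 B0 gamma0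
  gammaL gammaB gamma_sigma (a := fun k => \int[P]_w phi k w)).
- exact: le_trans (enorm_ge0 _) (b_le 0).
- by move=> k k0; apply: Rintegral_ge0 => w _; have /andP[] := phi_bound w k0.
- by move=> k; apply: Rintegral_ge0 => w _; exact: dotp_ge0.
- rewrite -[leRHS](Rint_cst P); apply: le_Rint; last 1 first.
  + by apply: aeW => w; have /andP[] := phi_bound w (ltn0Sn 0).
  + exact: Rintegrable_phi.
  + exact: Rintegrable_cst.
- rewrite -[leRHS](Rint_cst P); apply: le_Rint; last 1 first.
  + apply: aeW => w; have [s1 _] := acsa_iter_ball w (ltn0Sn 0).
    exact: dotpB_le_sqr.
  + exact: Rintegrable_dist.
  + exact: Rintegrable_cst.
move=> k gk /andP[k0 kN]; exact: (@expected_descent (Ordinal kN) k0).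
Qed.

End Iterates.
End StochasticObjective.

(** [expected_gap] is divided by [gamma * N ^+ 2], and [acsa_gamma_inv] bounds the resulting
    [r ^+ 2 / (gamma * N ^+ 2)]. *)
Theorem theorem1 (R : realType) :
  exists c : R, 0 < c /\
  forall (d : nat) (L r zeta sigma : R)
    (dT : measure_display) (T : measurableType dT) (D : probability T R)
    (f : 'rV[R]_d -> T -> R) (xstar : 'rV[R]_d) (b : 'rV[R]_d -> 'rV[R]_d),
  let F := objective D f in
  (0 < d)%N -> 0 < L -> 0 < r -> 0 <= zeta -> 0 <= sigma ->
  (forall x, D.-integrable [set: T] (EFin \o f x)) ->
  (forall z x, differentiable (f^~ z) x) ->
  {ae D, forall z, (forall x, 0 <= f x z) /\
     forall x y, f x z + dotp (grad (f^~ z) x) (y - x) <= f y z} ->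
  {ae D, forall z, (forall x, 0 <= f x z) /\
     forall x y, f y z <= f x z + dotp (grad (f^~ z) x) (y - x)
                          + L / 2 * enorm (y - x) ^+ 2} ->
  convex_function [set: 'rV[R]_d] F ->
  (forall x, F xstar <= F x) ->
  enorm xstar <= r ->
  ('E_D[fun z => (enorm (grad (f^~ z) xstar - grad F xstar) ^+ 2)%R]
     <= (sigma ^+ 2)%:E)%E ->
  measurable_fun [set: borel_rV R d] (b : borel_rV R d -> borel_rV R d) ->
  (forall x, enorm (b x) ^+ 2 <= zeta ^+ 2) ->
  forall (N B : nat) (x0 : 'rV[R]_d)
    (dO : measure_display) (Omega : measurableType dO) (P : probability Omega R)
    (xi : nat -> 'I_B -> Omega -> T),
  (0 < N)%N -> (0 < B)%N ->
  iid_sample P D (fun j : 'I_N * 'I_B => xi j.1 j.2) ->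
  ('E_P[fun w => (F (acsa_output L r sigma N (biased_oracle f b)
                       (fun k i => xi k i w) x0) - F xstar)%R]
   <= (c * (L * r ^+ 2 / N%:R ^+ 2
            + L * r ^+ 2 / (B%:R * N%:R)
            + sigma * r / Num.sqrt (B%:R * N%:R)
            + zeta * r
            + zeta ^+ 2 / (2 * L) * N%:R))%:E)%E.
Proof.
(* 42 comes from the recursion and 48 is the largest coefficient in [acsa_gamma_inv]; the product
   also dominates the 12 in front of [zeta * r]. *)
exists (42 * 48); split=> [|d L r zeta sigma dT T D f xstar b F _ L0 r0 zeta0 sigma0].
  by rewrite mulr_gt0 ?ltr0n.
move=> sf df ae_convex ae_smooth _ Fmin xsr var_xs mb b_le.
move=> N B x0 dO Omega P xi N0 B0 iid_xi.
have ae_convex' : {ae D, forall z, forall x y,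
    f x z + dotp (grad (f^~ z) x) (y - x) <= f y z}.
  by apply: filterS ae_convex => z [].
have ae_smooth' : {ae D, forall z, forall x y, f y z <=
    f x z + dotp (grad (f^~ z) x) (y - x) + L / 2 * dotp (y - x) (y - x)}.
  by apply: filterS ae_smooth => z [_ h] x y; rewrite -enormK.
have b_le' x : enorm (b x) <= zeta.
  by have := b_le x; rewrite ler_pXn2r ?nnegrE ?enorm_ge0.
have g0 := @acsa_gamma_gt0 R L r sigma N B L0 r0 sigma0 N0 B0.
have gL := @acsa_gamma_le_smooth R L r sigma N B L0.
have gB := @acsa_gamma_le_batch R L r sigma N B L0.
have gs := @acsa_gamma_le_noise R L r sigma N B L0 r0 sigma0 N0 B0.
have [sphi gap] := @expected_gap R d dT T D f L xstar L0 sf df ae_convex'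
  ae_smooth' Fmin sigma var_xs b r zeta _ x0 N B dO Omega P xi mb b_le' r0 xsr
  B0 iid_xi g0 gL gB gs N0.
rewrite unlock (RintegrableE sphi) lee_fin.
have inv := @acsa_gamma_inv R L r sigma N B L0 r0 sigma0 N0 B0.
have [[Np Bp] [L1 r1]] : (0 < N%:R :> R /\ 0 < B%:R :> R) /\ (0 <= L /\ 0 <= r).
  by rewrite !ltr0n !ltW.
move: gap inv; move: (acsa_gamma _ _ _ _ _) (\int[P]_w _) g0 => gamma gap g0.
have gN : 0 < gamma * N%:R ^+ 2 by rewrite mulr_gt0 ?exprn_gt0.
rewrite mulrC -ler_pdivlMr// mulrDl mulfK ?gt_eqF// -mulrA => le_gap inv.
have t1 : 0 <= L * r ^+ 2 / N%:R ^+ 2.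
  by rewrite divr_ge0 ?exprn_ge0 ?mulr_ge0 ?exprn_ge0// ltW.
have t2 : 0 <= L * r ^+ 2 / (B%:R * N%:R).
  by rewrite divr_ge0 ?mulr_ge0 ?exprn_ge0// ltW.
have t3 : 0 <= sigma * r / Num.sqrt (B%:R * N%:R).
  by rewrite divr_ge0 ?sqrtr_ge0 ?mulr_ge0.
have t4 : 0 <= zeta * r by rewrite mulr_ge0.
have t5 : 0 <= zeta ^+ 2 / (2 * L) * N%:R.
  by rewrite mulr_ge0 ?divr_ge0 ?exprn_ge0 ?mulr_ge0// ltW.
by lra.
Qed.
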